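(* Suppose that $\mathbf Z=(z,\mathbb Z)\in WG_p([0,T],\mathbb R^d,0)$ and $\mathbf U\in WG_p(O(M))$ solves $$d\mathbf U=B^\nabla_{d\mathbf Z_t}(u_t)\quad\text{with } u_0=u_o\in O(M)\text{ given}.$$ Then $\mathbf U$ is a parallel translation along $\mathbf X=\pi_*(\mathbf U)$, i.e. $\mathbf U$ satisfies $$d\mathbf U=V^\nabla_{d\mathbf X}(u)\quad\text{with } u(0)=u_o.$$
   Context: Fix $T>0$, $p\in[2,3)$ and a control $\omega$, i.e. a continuous superadditive function $\omega:\{(s,t):0\le s\le t\le T\}\to[0,\infty)$ vanishing on the diagonal and positive off it. For a finite-dimensional normed space $W$, $WG_p(W)$ is the set of pairs $\mathbf X=(x,\mathbb X)$ of continuous maps $x:[0,T]\to W$ (the trace) and $\mathbb X:\{0\le s\le t\le T\}\to W\otimes W$ such that, with $x_{s,t}=x_t-x_s$: $\mathbb X_{s,t}=\mathbb X_{s,u}+\mathbb X_{u,t}+x_{s,u}\otimes x_{u,t}$ for $s\le u\le t$; $\sup_{s<t}|x_{s,t}|/\omega(s,t)^{1/p}<\infty$ and $\sup_{s<t}|\mathbb X_{s,t}|/\omega(s,t)^{2/p}<\infty$; and the symmetric part of $\mathbb X_{s,t}$ equals $\frac12 x_{s,t}\otimes x_{s,t}$. $WG_p([0,T],W,o)$ denotes those with $x_0=o$. For continuous $g,h$ on $\{s\le t\}$, $g_{s,t}\simeq h_{s,t}$ means: there are $\delta>0$ and $C$ with $|g_{s,t}-h_{s,t}|\le C\,\omega(s,t)^{3/p}$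 whenever $|t-s|\le\delta$. For bilinear $B$ and a tensor $A$, $B(a,b)|_{a\otimes b=A}$ denotes $\hat B(A)$, where $\hat B$ is the linear map on the tensor product with $\hat B(a\otimes b)=B(a,b)$. $E=\mathbb R^N$ and $M\subset E$ is an embedded submanifold of dimension $d$ (locally the zero set of a smooth map $F:U\to\mathbb R^{N-d}$, $U\subset E$ open, with surjective differential); $\tau_mM=\mathrm{Nul}(F'(m))\cong T_mM$; $P(m)$ is the orthogonal projection of $E$ onto $\tau_mM$, $Q=I_E-P$, and $dQ(\xi)$ is the derivative of $Q$ at $m$ along $\xi\in\tau_mM$. $\Gamma(TM)$ is the set of smooth vector fields $Y:M\to E$, $Y(m)\in\tau_mM$. The same definitions apply to submanifolds of other Euclidean spaces. For $U\subset E$ open, a smooth $\alpha:U\to\mathrm{Hom}(E,W)$ and $\mathbf X\in WG_p(E)$ with trace in $U$, $\int\alpha(d\mathbf X)$ is the unique $\mathbf Y=(y,\mathbb Y)\in WG_p(W)$ with $y_0=0$, $y_{s,t}\simeq\alpha(x_s)x_{s,t}+\alpha'(x_s)\mathbb X_{s,t}$, $\mathbb Y_{s,t}\simeq[\alpha(x_s)\otimes\alpha(x_s)]\mathbb X_{s,t}$, where $\alpha'(x)[v\otimes w]=(\partial_v\alpha)(x)w$. $WG_p(M)$ is the set of $\mathbf X\in WG_p(E)$ whose trace lies in $M$ and such that $\int\tilde\alpha(d\mathbf X)\equiv0$ for every finite-dimensional $W$ and every smooth $W$-valued one-form $\tilde\alpha$ on $E$ with $\tilde\alpha|_{TM}\equiv0$.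 For $\mathbf X\in WG_p(M)$ and a smooth one-form $\alpha$ on $M$, $\int\alpha(d\mathbf X):=\int\tilde\alpha(d\mathbf X)$ for any smooth extension $\tilde\alpha$ of $\alpha$ to a neighbourhood of $M$. For a smooth map $\varphi:M\to N$ into a submanifold $N\subset E'$, $\varphi_*(\mathbf X):=\int d\varphi(d\mathbf X)$ with $d\varphi$ viewed as an $E'$-valued one-form and with starting point $\varphi(x_0)$. RDE on a manifold $N$ (embedded in a Euclidean space) with linear $Y:\mathbb R^n\to\Gamma(TN)$ driven by $\mathbf Z=(z,\mathbb Z)\in WG_p(\mathbb R^n)$: $\mathbf X\in WG_p(N)$ solves $d\mathbf X=Y_{d\mathbf Z}(x)$ if $x_{s,t}\simeq Y_{z_{s,t}}(x_s)+(\partial_{Y_a}Y_b)(x_s)|_{a\otimes b=\mathbb Z_{s,t}}$ and $\mathbb X_{s,t}\simeq Y_a(x_s)\otimes Y_b(x_s)|_{a\otimes b=\mathbb Z_{s,t}}$. Frame bundle: $O(M)=\{(m,g):m\in M,\ g:\mathbb R^d\to\tau_mM\text{ a linear isometry}\}$, an embedded submanifold of $E\times\mathrm{Hom}(\mathbb R^d,E)$, with projection $\pi(m,g)=m$. For $W\in\Gamma(TM)$ its horizontal lift is $W^\nabla(m,g)=(W(m),-dQ(W(m))g)$. For $z\in E$, $V_z(m)=P(m)z$, $V_z^\nabla=(V_z)^\nabla$. For $a\in\mathbb R^d$, $B^\nabla_a(m,g)=(ga,-dQ(ga)g)$. The RDE $d\mathbf U=V^\nabla_{d\mathbf X}(u)$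 is driven by $\mathbf X$ regarded as an element of $WG_p(E)$. *)

(* Defs.v *)
From mathcomp Require Import all_boot all_order all_algebra.
From mathcomp Require Import all_classical all_reals all_analysis.

Set Implicit Arguments.
Unset Strict Implicit.
Unset Printing Implicit Defensive.
Import Order.TTheory GRing.Theory Num.Theory.
Import numFieldNormedType.Exports.
Local Open Scope classical_set_scope.
Local Open Scope ring_scope.

(* R^n is ['rV[R]_n]; a linear map R^n -> R^k is a matrix acting on the right
   of row vectors, v |-> v *m A.  The library norm is the max norm: all norms
   below occur in bounds up to a constant, so the choice is immaterial.  The
   Euclidean structure is given by [dot] and [enorm]. *)

Definition dot {R : realType} {n} (u v : 'rV[R]_n) : R := (u *m v^T) 0 0.

Definition enorm {R : realType} {n} (u : 'rV[R]_n) : R := Num.sqrt (dot u u).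

(* R^n (x) R^n is ['M[R]_n], with e_i (x) e_j the elementary matrix at (i, j). *)
Definition tens {R : realType} {n} (a b : 'rV[R]_n) : 'M[R]_n := a^T *m b.

(* [tens_ext B A] is B(a, b) evaluated at a (x) b = A, for bilinear B. *)
Definition tens_ext {R : realType} {n} {V : lmodType R}
    (B : 'rV[R]_n -> 'rV[R]_n -> V) (A : 'M[R]_n) : V :=
  \sum_(i < n) \sum_(j < n) A i j *: B (delta_mx 0 i) (delta_mx 0 j).

Section Smoothness.
Context {R : realType}.

(* C^k on an open set O of a finite-dimensional space *)
Fixpoint Ck_on {V W : normedModType R} (k : nat) (O : set V) (f : V -> W) :
    Prop :=
  match k with
  | 0 => forall x, O x -> {for x, continuous f}
  | k'.+1 => (forall x, O x -> differentiable f x) /\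
             forall v, Ck_on k' O (fun x => 'D_v f x)
  end.

Definition smooth_on {V W : normedModType R} (O : set V) (f : V -> W) : Prop :=
  forall k, Ck_on k O f.

End Smoothness.

Section Submanifolds.
Context {R : realType}.

Definition local_defining {n} (M : set 'rV[R]_n) (m : 'rV[R]_n) (k : nat)
    (O : set 'rV[R]_n) (F : 'rV[R]_n -> 'rV[R]_k) : Prop :=
  [/\ open O, O m, smooth_on O F,
      forall x, O x -> forall w, exists v, 'd F x v = w
    & M `&` O = [set x | O x /\ F x = 0]].

Definition submanifold {n} (d : nat) (M : set 'rV[R]_n) : Prop :=
  (d <= n)%N /\
  forall m, M m -> exists O (F : 'rV[R]_n -> 'rV[R]_(n - d)),
    local_defining M m O F.

(* Nul (F'(m)); it does not depend on the local defining map F *)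
Definition tangent {n} (M : set 'rV[R]_n) (m : 'rV[R]_n) : set 'rV[R]_n :=
  [set v | exists k O (F : 'rV[R]_n -> 'rV[R]_k),
    local_defining M m O F /\ 'd F m v = 0].

Definition orth_proj {n} (S : set 'rV[R]_n) : 'M[R]_n :=
  xget 0 [set A : 'M[R]_n |
    forall z, S (z *m A) /\ forall w, S w -> dot (z - z *m A) w = 0].

Definition projP {n} (M : set 'rV[R]_n) (m : 'rV[R]_n) : 'M[R]_n :=
  orth_proj (tangent M m).

Definition projQ {n} (M : set 'rV[R]_n) (m : 'rV[R]_n) : 'M[R]_n :=
  1%:M - projP M m.

(* Derivative at m, along v tangent to M at m, of a map f that is smooth on M:
   the values of f off M are irrelevant, the derivative is that of any smooth
   extension of f near m. *)
Definition mderive {n} {V : normedModType R} (M : set 'rV[R]_n)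
    (f : 'rV[R]_n -> V) (m v : 'rV[R]_n) : V :=
  xget 0 [set w | exists O (g : 'rV[R]_n -> V),
    [/\ open O, O m, smooth_on O g,
        forall x, M x -> O x -> g x = f x & w = 'D_v g m]].

Definition dQ {n} (M : set 'rV[R]_n) (m v : 'rV[R]_n) : 'M[R]_n :=
  mderive M (projQ M) m v.

End Submanifolds.

Section RoughPaths.
Context {R : realType}.

Definition rpath n : Type := ((R -> 'rV[R]_n) * (R -> R -> 'M[R]_n))%type.

Definition incr {n} (x : R -> 'rV[R]_n) (s t : R) : 'rV[R]_n := x t - x s.

Definition simplex (T : R) : set (R * R) :=
  [set st | 0 <= st.1 /\ st.1 <= st.2 <= T].

Variables (T p : R) (omega : R -> R -> R).

Definition control : Prop :=
  [/\ {within simplex T, continuous (fun st => omega st.1 st.2)},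
      forall s u t, 0 <= s -> s <= u <= t -> t <= T ->
        omega s u + omega u t <= omega s t,
      forall t, 0 <= t <= T -> omega t t = 0
    & forall s t, 0 <= s -> s < t <= T -> 0 < omega s t].

Definition WG {n} (X : rpath n) : Prop :=
  let: (x, XX) := X in
  [/\ {within `[0, T], continuous x},
      {within simplex T, continuous (fun st => XX st.1 st.2)},
      forall s u t, 0 <= s -> s <= u <= t -> t <= T ->
        XX s t = XX s u + XX u t + tens (incr x s u) (incr x u t),
      exists C : R, forall s t, 0 <= s -> s < t <= T ->
        `|incr x s t| / omega s t `^ p^-1 <= C /\
        `|XX s t| / omega s t `^ (2 / p) <= C
    & forall s t, 0 <= s -> s <= t <= T ->
        2^-1 *: (XX s t + (XX s t)^T) =
        2^-1 *: tens (incr x s t) (incr x s t)].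

Definition approx {V : normedModType R} (g h : R -> R -> V) : Prop :=
  exists delta C : R, 0 < delta /\
    forall s t, 0 <= s -> s <= t <= T -> t - s <= delta ->
      `|g s t - h s t| <= C * omega s t `^ (3 / p).

(* Y is the integral of the one-form alpha against X; only the values of alpha
   near the trace of X matter. *)
Definition is_rough_integral {n k} (alpha : 'rV[R]_n -> 'M[R]_(n, k))
    (X : rpath n) (Y : rpath k) : Prop :=
  let: (x, XX) := X in
  let: (y, YY) := Y in
  [/\ WG Y, y 0 = 0,
      approx (incr y)
        (fun s t => incr x s t *m alpha (x s) +
           tens_ext (fun v w => w *m 'D_v alpha (x s)) (XX s t))
    & approx YY
        (fun s t => tens_ext
           (fun v w => tens (v *m alpha (x s)) (w *m alpha (x s))) (XX s t))].

Definition rpath0 {k} : rpath k := (fun=> 0, fun _ _ => 0).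

(* Rough integrals are unique, so an integral vanishes identically exactly when
   the zero path is an integral. *)
Definition WG_on {n} (M : set 'rV[R]_n) (X : rpath n) : Prop :=
  [/\ WG X,
      forall t, 0 <= t <= T -> M (X.1 t)
    & forall k (alpha : 'rV[R]_n -> 'M[R]_(n, k)),
        smooth_on setT alpha ->
        (forall m v, M m -> tangent M m v -> v *m alpha m = 0) ->
        is_rough_integral alpha X rpath0].

(* Integral of a one-form on M, given by its values alpha m v for m in M and v
   tangent at m; it does not depend on the smooth extension beta of alpha. *)
Definition rough_integral_on {n k} (M : set 'rV[R]_n)
    (alpha : 'rV[R]_n -> 'rV[R]_n -> 'rV[R]_k) (X : rpath n) : rpath k :=
  xget rpath0 [set Y | exists O (beta : 'rV[R]_n -> 'M[R]_(n, k)),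
    [/\ open O, M `<=` O, smooth_on O beta,
        forall m v, M m -> tangent M m v -> v *m beta m = alpha m v
      & is_rough_integral beta X Y]].

Definition rough_pushforward {n k} (M : set 'rV[R]_n)
    (phi : 'rV[R]_n -> 'rV[R]_k) (X : rpath n) : rpath k :=
  let: (y, YY) := rough_integral_on M (mderive M phi) X in
  (fun t => phi (X.1 0) + y t, YY).

(* X solves dX = Y_{dZ}(x) on the submanifold M; Y a x stands for Y_a(x) and is
   only used for x in M. *)
Definition RDE_solution {q n} (M : set 'rV[R]_n)
    (Y : 'rV[R]_q -> 'rV[R]_n -> 'rV[R]_n) (Z : rpath q) (X : rpath n) : Prop :=
  let: (z, ZZ) := Z in
  let: (x, XX) := X in
  [/\ WG Z, WG_on M X,
      approx (incr x)
        (fun s t => Y (incr z s t) (x s) +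
           tens_ext (fun a b => mderive M (Y b) (x s) (Y a (x s))) (ZZ s t))
    & approx XX
        (fun s t => tens_ext (fun a b => tens (Y a (x s)) (Y b (x s)))
           (ZZ s t))].

End RoughPaths.

Section FrameBundle.
Context {R : realType} {N d : nat}.

(* A point (m, g) of R^N x Hom(R^d, R^N) is the row vector (m, mxvec g) of
   length N + d * N, with g a d x N matrix: g applied to a is a *m g, and
   A o g, for A in End(R^N), is g *m A. *)
Definition frame_pair (m : 'rV[R]_N) (g : 'M[R]_(d, N)) : 'rV[R]_(N + d * N) :=
  row_mx m (mxvec g).

Definition frame_pi (u : 'rV[R]_(N + d * N)) : 'rV[R]_N := lsubmx u.

Definition frame_map (u : 'rV[R]_(N + d * N)) : 'M[R]_(d, N) :=
  vec_mx (rsubmx u).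

Variable M : set 'rV[R]_N.

Definition frame_bundle : set 'rV[R]_(N + d * N) :=
  [set u | M (frame_pi u) /\
    forall a, tangent M (frame_pi u) (a *m frame_map u) /\
              enorm (a *m frame_map u) = enorm a].

Definition hlift (W : 'rV[R]_N -> 'rV[R]_N) (u : 'rV[R]_(N + d * N)) :
    'rV[R]_(N + d * N) :=
  let m := frame_pi u in
  frame_pair (W m) (- (frame_map u *m dQ M m (W m))).

Definition Vfield (z m : 'rV[R]_N) : 'rV[R]_N := z *m projP M m.

Definition Vlift (z : 'rV[R]_N) : 'rV[R]_(N + d * N) -> 'rV[R]_(N + d * N) :=
  hlift (Vfield z).

Definition Blift (a : 'rV[R]_d) (u : 'rV[R]_(N + d * N)) :
    'rV[R]_(N + d * N) :=
  let m := frame_pi u in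
  let g := frame_map u in
  frame_pair (a *m g) (- (g *m dQ M m (a *m g))).

End FrameBundle.

(* Main.v *)
Require Import Defs.
From HB Require Import structures.
From mathcomp Require Import all_boot all_order all_algebra.
From mathcomp Require Import all_classical all_reals all_analysis.
From mathcomp Require Import ring.
Set Implicit Arguments.
Unset Strict Implicit.
Unset Printing Implicit Defensive.
Import Order.TTheory GRing.Theory Num.Theory.
Import numFieldNormedType.Exports.
Local Open Scope classical_set_scope.
Local Open Scope ring_scope.

(** Fix a frame [u = (m, g)] and write [H] for the horizontal lift at [u], so
    that [V_w = H w] at [u].  As a frame takes tangent values, [B_a = H (g a)]:
    the two families of fields are the same lift with different arguments.  Let
    [U] be driven by [Z] through [B], and let [X] be its projection.  Projecting
    the expansion of [U] gives the expansion of [X] in terms of [Z],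

      x_{s,t}  ~  g z_{s,t} + pi (D_{B_a} B_b) at a (x) b = ZZ_{s,t},
      XX_{s,t} ~  g a (x) g b at a (x) b = ZZ_{s,t}.

    Differentiating the identity [B_b = H (pi B_b)] along [B_a] yields

      D_{B_a} B_b  =  H (pi (D_{B_a} B_b)) + D_{V_v} V_w at v = g a, w = g b

    ([Blift_deriv_split]).  Inserted into the expansion of [U] in terms of [Z],
    it turns the terms in [z] and [ZZ] into [H x_{s,t}] plus the derivatives
    [D_{V_v} V_w] at [v (x) w = XX_{s,t}], which is the equation driven by [X].
    The second level is the same computation without derivatives.

    Three points carry this out.

    First, the fields are only given on the frame bundle, through projections
    and derivatives along [M].  On the zero set of a submersion, the derivative
    along a tangent vector does not depend on the extension
    ([derive_vanishing]), because tangent vectors are limits of secants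
    ([tangent_approx]).  Smooth extensions are given by the explicit formula
    [J (J^T J)^-1 J^T] for the normal projection in terms of the Jacobian [J]
    of a local defining map of [M].  The frame bundle is itself locally the
    zero set of a submersion, to which the horizontal fields are tangent
    ([frame_local_defining], [lift_tangent]).

    Second, the projection of [U] is the rough integral of some one-form that
    is known only on vectors tangent to the frame bundle.  This determines its
    expansion: the form takes prescribed values on the fields [B_b] along the
    frame bundle, and derivatives of these values along [B_a] are all that
    enters ([eq_Blift_form], [pi_first_level]).

    Third, approximate equality is preserved by the linear maps involved since
    their norms are bounded along the compact trace of [U] ([trace_bounded]). *)
(** * Functions of class C^k *)

Section Calculus.
Context {R : realType} {V : normedModType R}.
Implicit Types (O : set V) (x v : V).

(** The difference of the two functions vanishes near [x], so it is
    differentiable there with differential 0. *)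
Lemma near_eq_differentiable {W : normedModType R} (f g : V -> W) x :
  {near x, f =1 g} -> differentiable f x -> differentiable g x.
Proof.
move=> fg df.
suff dh : differentiable (g - f) x.
  by rewrite -(subrK f g); exact: differentiableD.
have hz : {near x, (g - f : V -> W) =1 cst 0}.
  by apply: filterS fg => y fgy; change (g y - f y = 0); rewrite fgy subrr.
have h0 : (g - f : V -> W) x = 0 by exact: (nbhs_singleton hz).
apply/diff_locallyP.
have hx : (g - f : V -> W) \o shift x =
   cst ((g - f : V -> W) x) + (\0 : {linear V -> W}) +o_ (0 : V) id.
  apply/eqaddoP => e e0; near=> y.
  have h : (g - f : V -> W) (y + x) = 0.
    by near: y; move/nbhs0P : hz; apply: filterS => y /=; rewrite [x + y]addrC.
  have -> : ((g - f : V -> W) \o shift x - (cst ((g - f) x) + \0%R)) y = 0.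
    change ((g - f : V -> W) (y + x) - ((g - f : V -> W) x + 0) = 0).
    by rewrite h h0 addr0 subr0.
  by rewrite normr0 mulr_ge0 // ltW.
have -> : 'd (g - f : V -> W) x = (\0 : {linear V -> W}) :> (V -> W).
  by apply: diff_unique => // y; exact: cst_continuous.
by split => // y; exact: cst_continuous.
Unshelve. all: by end_near. Qed.

(** Formulas for derivatives (of sums, products, inverses) hold only where the
    functions are differentiable, that is on [O]; this lemma lets the
    inductions below use them under the iterated derivative of [Ck_on]. *)
Lemma Ck_ext {W : normedModType R} k O (f g : V -> W) :
  open O -> (forall x, O x -> f x = g x) -> Ck_on k O f -> Ck_on k O g.
Proof.
move=> oO; elim: k f g => [|k IH] f g fg /=.
- move=> cf x Ox; have fgx : {near x, f =1 g}.
    by apply: (filterS fg); exact: open_nbhs_nbhs.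
  rewrite /prop_for /continuous_at -(fg _ Ox).
  exact: cvg_trans (near_eq_cvg fgx) (cf x Ox).
- move=> [df Df]; split => [x Ox|v].
    apply: near_eq_differentiable (df x Ox).
    by apply: (filterS fg); exact: open_nbhs_nbhs.
  apply: IH (Df v) => x Ox; apply: near_eq_derive.
  by apply: (filterS fg); exact: open_nbhs_nbhs.
Qed.

Lemma Ck_sub {W : normedModType R} k O O' (f : V -> W) :
  O' `<=` O -> Ck_on k O f -> Ck_on k O' f.
Proof.
move=> sO; elim: k f => [|k IH] f /=; first by move=> cf x /sO; exact: cf.
by move=> [df Df]; split => [x /sO|v]; [exact: df|exact/IH/Df].
Qed.

Lemma CkW {W : normedModType R} k O (f : V -> W) :
  Ck_on k.+1 O f -> Ck_on k O f.
Proof.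
elim: k f => [|k IH] f.
  by move=> [df _] x /df; exact: differentiable_continuous.
by move=> [df Df]; split => // v; exact/IH/Df.
Qed.

Lemma Ck_cst {W : normedModType R} k O (a : W) : Ck_on k O (fun=> a : W).
Proof.
elim: k a => [|k IH] a /=; first by move=> x _; exact: cst_continuous.
split=> [x _|v]; first exact: differentiable_cst.
rewrite (_ : (fun x => 'D_v (fun=> a) x) = fun=> (0 : W)); first exact: IH.
by apply/funext => x; rewrite derive_cst.
Qed.

Lemma CkD {W : normedModType R} k O (f g : V -> W) : open O ->
  Ck_on k O f -> Ck_on k O g -> Ck_on k O (fun x => f x + g x).
Proof.
move=> oO; elim: k f g => [|k IH] f g /=.
  by move=> cf cg x Ox; apply: continuousD; [exact: cf|exact: cg].
move=> [df Df] [dg Dg]; split=> [x Ox|v].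
  by apply: differentiableD; [exact: df|exact: dg].
apply: (Ck_ext oO _ (IH _ _ (Df v) (Dg v))) => x Ox.
by rewrite -deriveD //; apply: diff_derivable; [exact: df|exact: dg].
Qed.

Lemma CkN {W : normedModType R} k O (f : V -> W) : open O ->
  Ck_on k O f -> Ck_on k O (fun x => - f x).
Proof.
move=> oO; elim: k f => [|k IH] f /=.
  by move=> cf x Ox; apply: continuousN; exact: cf.
move=> [df Df]; split=> [x Ox|v].
  by apply: differentiableN; exact: df.
apply: (Ck_ext oO _ (IH _ (Df v))) => x Ox.
by rewrite -deriveN //; apply: diff_derivable; exact: df.
Qed.

(** The derivative [f Dg + g Df] still involves [f] and [g] themselves, at the
    lower order: hence the appeal to [CkW]. *)
Lemma CkM k O (f g : V -> R) : open O ->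
  Ck_on k O f -> Ck_on k O g -> Ck_on k O (fun x => f x * g x).
Proof.
move=> oO; elim: k f g => [|k IH] f g.
  by move=> cf cg x Ox; apply: continuousM; [exact: cf|exact: cg].
move=> f1 g1; have [df Df] := f1; have [dg Dg] := g1.
split=> [x Ox|v].
  by apply: differentiableM; [exact: df|exact: dg].
apply: (@Ck_ext _ _ _ (fun x => f x * 'D_v g x + g x * 'D_v f x)) => //.
  move=> x Ox; rewrite (deriveM (f := f) (g := g)) //.
  - exact/diff_derivable/df.
  - exact/diff_derivable/dg.
have f0 := CkW f1; have g0 := CkW g1.
by apply: CkD => //; apply: IH => //; [exact: Dg|exact: Df].
Qed.

(** The derivative of [1/f] is [- (1/f)^2 Df], so the induction on the order
    feeds on its own conclusion. *)
Lemma CkV k O (f : V -> R) : open O -> (forall x, O x -> f x != 0) ->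
  Ck_on k O f -> Ck_on k O (fun x => (f x)^-1).
Proof.
move=> oO fn0; elim: k => [|k IH].
  by move=> cf x Ox; apply: continuousV; [exact: fn0|exact: cf].
move=> f1; have [df Df] := f1; have fV := IH (CkW f1).
split=> [x Ox|v].
  by apply: differentiableV; [exact: df|exact: fn0].
apply: (@Ck_ext _ _ _ (fun x => - ((f x)^-1 * (f x)^-1 * 'D_v f x))) => //.
  move=> x Ox; rewrite deriveV ?fn0 //; last exact/diff_derivable/df.
  by rewrite expr2 invfM /GRing.scale /= mulNr.
by apply: CkN => //; apply: CkM => //; [apply: CkM|exact: Df].
Qed.

Lemma Ck_sum {W : normedModType R} k O (I : Type) (r : seq I) (P : pred I)
    (f : I -> V -> W) : open O ->
  (forall i, P i -> Ck_on k O (f i)) ->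
  Ck_on k O (fun x => \sum_(i <- r | P i) f i x).
Proof.
move=> oO Cf; elim: r => [|i r IH].
  rewrite (_ : (fun x => \sum_(i <- [::] | P i) f i x) = fun=> 0).
    exact: Ck_cst.
  by apply/funext => x; rewrite big_nil.
rewrite (_ : (fun x => \sum_(j <- i :: r | P j) f j x) =
  fun x => (if P i then f i x else 0) +
    \sum_(j <- r | P j) f j x); last first.
  by apply/funext => x; rewrite [LHS]big_cons; case: (P i); rewrite ?add0r.
by apply: CkD => //; have := Cf i; case: (P i) => [/(_ isT)//|_]; exact: Ck_cst.
Qed.

Lemma Ck_prod k O (I : Type) (r : seq I) (f : I -> V -> R) : open O ->
  (forall i, Ck_on k O (f i)) ->
  Ck_on k O (fun x => \prod_(i <- r) f i x).
Proof.
move=> oO Cf; elim: r => [|i r IH].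
  rewrite (_ : (fun x => \prod_(i <- [::]) f i x) = fun=> 1).
    exact: Ck_cst.
  by apply/funext => x; rewrite big_nil.
rewrite (_ : (fun x => \prod_(j <- i :: r) f j x) =
  fun x => f i x * \prod_(j <- r) f j x); last first.
  by apply/funext => x; rewrite big_cons.
exact: CkM.
Qed.

Lemma derive_entry {m n} (f : V -> 'M[R]_(m, n)) x v i j :
  derivable f x v -> 'D_v (fun y => f y i j) x = ('D_v f x) i j.
Proof. by move=> df; rewrite derive_mx // mxE. Qed.

Lemma differentiable_entry {m n} (f : V -> 'M[R]_(m, n)) x i j :
  differentiable f x -> differentiable (fun y => f y i j : R) x.
Proof.
move=> df; apply: (@differentiable_comp _ _ _ _ f
  (fun A : 'M[R]_(m, n) => A i j)) => //; exact: differentiable_coord.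
Qed.

Lemma Ck_entry {m n} k O (f : V -> 'M[R]_(m, n)) i j : open O ->
  Ck_on k O f -> Ck_on k O (fun x => f x i j).
Proof.
move=> oO; elim: k f => [|k IH] f /=.
  move=> cf x Ox; apply: (@continuous_comp _ _ _ f
    (fun A : 'M[R]_(m, n) => A i j)); [exact: cf|exact: coord_continuous].
move=> [df Df]; split=> [x Ox|v].
  exact/differentiable_entry/df.
apply: (Ck_ext oO _ (IH _ (Df v))) => x Ox.
by rewrite derive_entry //; exact/diff_derivable/df.
Qed.

Lemma matrix_entries {m n} (f : V -> 'M[R]_(m, n)) :
  f = fun x => \sum_(i < m) \sum_(j < n) f x i j *: delta_mx i j.
Proof. by apply/funext => x; exact: matrix_sum_delta. Qed.

Lemma differentiable_entries {m n} (f : V -> 'M[R]_(m, n)) x :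
  (forall i j, differentiable (fun y => f y i j : R) x) -> differentiable f x.
Proof.
move=> df; rewrite (matrix_entries f).
rewrite (_ : (fun x => _) = \sum_(i < m) \sum_(j < n)
   (fun x => f x i j *: delta_mx i j)); last first.
  apply/funext => y; rewrite fct_sumE; apply: eq_bigr => i _.
  by rewrite fct_sumE.
apply: differentiable_sum => i; apply: differentiable_sum => j.
exact: differentiableZl.
Qed.

(** Smoothness of matrix-valued functions is reduced to that of their entries,
    where the ring operations of the scalars are available. *)
Lemma Ck_entries {m n} k O (f : V -> 'M[R]_(m, n)) : open O ->
  (forall i j, Ck_on k O (fun x => f x i j)) -> Ck_on k O f.
Proof.
move=> oO; elim: k f => [|k IH] f Cf.
  move=> x Ox; rewrite (matrix_entries f).
  apply: (@Ck_sum _ 0 O) => // i _; apply: Ck_sum => // j _ y Oy.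
  by apply: continuousZr_tmp; exact: Cf.
have df x : O x -> differentiable f x.
  move=> Ox; apply: differentiable_entries => i j.
  by have [+ _] := Cf i j; exact.
split=> // v; apply: IH => i j; have [_ Df] := Cf i j.
apply: (Ck_ext oO _ (Df v)) => x Ox.
by rewrite derive_entry //; exact/diff_derivable/df.
Qed.

End Calculus.

Section LinearMaps.
Context {R : realType}.

(** A linear map on matrices is a finite combination of the coordinates. *)
Lemma mx_linear_continuous {m n} {W : normedModType R}
  (L : {linear 'M[R]_(m, n) -> W}) : continuous L.
Proof.
have -> : L = (fun A => \sum_(i < m) \sum_(j < n) A i j *: L (delta_mx i j))
    :> (_ -> _).
  apply/funext => A; rewrite [in LHS](matrix_sum_delta A) linear_sum.
  apply: eq_bigr => i _; rewrite linear_sum; apply: eq_bigr => j _.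
  by rewrite linearZ.
move=> A; apply: (@Ck_sum R 'M[R]_(m, n) W 0 setT) => //; first exact: openT.
move=> i _; apply: Ck_sum => [|j _ B _]; first exact: openT.
by apply: continuousZr_tmp; exact: coord_continuous.
Qed.

Lemma derive_lin {V W W' : normedModType R} (L : {linear W -> W'})
    (f : V -> W) x v : continuous L -> differentiable f x ->
  'D_v (fun y => L (f y)) x = L ('D_v f x).
Proof.
move=> cL df; rewrite (@deriveE _ _ _ (L \o f)); last first.
  by apply: differentiable_comp => //; exact: linear_differentiable.
rewrite diff_comp //=; last exact: linear_differentiable.
by rewrite diff_lin // deriveE.
Qed.

Lemma Ck_lin {V W W' : normedModType R} (L : {linear W -> W'}) k (O : set V)
    (f : V -> W) : continuous L -> open O ->
  Ck_on k O f -> Ck_on k O (fun x => L (f x)).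
Proof.
move=> cL oO; elim: k f => [|k IH] f /=.
  by move=> cf x Ox; apply: continuous_comp; [exact: cf|exact: cL].
move=> [df Df]; split=> [x Ox|v].
  apply: differentiable_comp; [exact: df|exact: linear_differentiable].
apply: (Ck_ext oO _ (IH _ (Df v))) => x Ox.
by rewrite derive_lin //; exact: df.
Qed.

Lemma derive_comp_lin {V' V W : normedModType R} (L : {linear V' -> V})
    (f : V -> W) x v : continuous L -> differentiable f (L x) ->
  'D_v (fun y => f (L y)) x = 'D_(L v) f (L x).
Proof.
move=> cL df; rewrite (@deriveE _ _ _ (f \o L)); last first.
  by apply: differentiable_comp => //; exact: linear_differentiable.
rewrite diff_comp //=; last exact: linear_differentiable.
by rewrite diff_lin // deriveE.
Qed.

Lemma Ck_comp_lin {V' V W : normedModType R} (L : {linear V' -> V}) k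
    (O : set V) (f : V -> W) : continuous L -> open O ->
  Ck_on k O f -> Ck_on k (L @^-1` O) (fun x => f (L x)).
Proof.
move=> cL oO.
have oO' : open (L @^-1` O) by apply: open_comp => // x _; exact: cL.
elim: k f => [|k IH] f /=.
  by move=> cf x Ox; apply: continuous_comp; [exact: cL|exact: cf].
move=> [df Df]; split=> [x Ox|v].
  apply: differentiable_comp; [exact: linear_differentiable|exact: df].
apply: (Ck_ext oO' _ (IH _ (Df (L v)))) => x Ox.
by rewrite derive_comp_lin //; exact: df.
Qed.

End LinearMaps.

Section MatrixCalculus.
Context {R : realType} {V : normedModType R}.
Implicit Types (O : set V) (x v : V).

Lemma Ck_mulmx {m n p} k O (f : V -> 'M[R]_(m, n)) (g : V -> 'M[R]_(n, p)) :
  open O -> Ck_on k O f -> Ck_on k O g -> Ck_on k O (fun x => f x *m g x).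
Proof.
move=> oO Cf Cg; apply: Ck_entries => // i j.
rewrite (_ : (fun x => (f x *m g x) i j) =
    fun x => \sum_l f x i l * g x l j); last by apply/funext => x; rewrite mxE.
by apply: Ck_sum => // l _; apply: CkM => //; exact: Ck_entry.
Qed.

Lemma differentiable_mulmx {m n p} (f : V -> 'M[R]_(m, n))
    (g : V -> 'M[R]_(n, p)) x :
  differentiable f x -> differentiable g x ->
  differentiable (fun x => f x *m g x) x.
Proof.
move=> df dg; apply: differentiable_entries => i j.
rewrite (_ : (fun x => (f x *m g x) i j) =
    \sum_l (fun x => f x i l * g x l j)); last first.
  by apply/funext => y; rewrite mxE fct_sumE.
apply: differentiable_sum => l.
by apply: differentiableM; exact: differentiable_entry.
Qed.

Lemma derive_mulmx {m n p} (f : V -> 'M[R]_(m, n)) (g : V -> 'M[R]_(n, p))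
    x v : differentiable f x -> differentiable g x ->
  'D_v (fun x => f x *m g x) x = 'D_v f x *m g x + f x *m 'D_v g x.
Proof.
move=> df dg; have dfg := differentiable_mulmx df dg.
apply/matrixP => i j; rewrite -derive_entry; last exact: diff_derivable.
rewrite (_ : (fun x => (f x *m g x) i j) =
    \sum_l (fun x => f x i l * g x l j)); last first.
  by apply/funext => y; rewrite mxE fct_sumE.
have dfe i' j' : derivable (fun y => f y i' j') x v.
  exact/diff_derivable/differentiable_entry.
have dge i' j' : derivable (fun y => g y i' j') x v.
  exact/diff_derivable/differentiable_entry.
rewrite derive_sum; last by move=> l; exact: derivableM.
rewrite !mxE -big_split /=; apply: eq_bigr => l _.
rewrite (deriveM (f := fun y => f y i l) (g := fun y => g y l j)) //.
rewrite !derive_entry; [|exact: diff_derivable..].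
by rewrite addrC /GRing.scale /= [g x l j * _]mulrC.
Qed.

Lemma Ck_det {n} k O (f : V -> 'M[R]_n) : open O ->
  Ck_on k O f -> Ck_on k O (fun x => \det (f x)).
Proof.
move=> oO Cf; rewrite /determinant; apply: Ck_sum => // s _.
apply: CkM => //; first exact: Ck_cst.
by apply: Ck_prod => // i; exact: Ck_entry.
Qed.

(** By Cramer's rule the inverse is a quotient of polynomials in the entries. *)
Lemma Ck_invmx {n} k O (f : V -> 'M[R]_n) : open O ->
  (forall x, O x -> f x \in unitmx) ->
  Ck_on k O f -> Ck_on k O (fun x => invmx (f x)).
Proof.
move=> oO fu Cf.
apply: (@Ck_ext _ _ _ _ _ (fun x => (\det (f x))^-1 *: \adj (f x))) => //.
  by move=> x Ox; rewrite /invmx fu.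
apply: Ck_entries => // i j.
rewrite (_ : (fun x => ((\det (f x))^-1 *: \adj (f x)) i j) =
    fun x => (\det (f x))^-1 * cofactor (f x) j i); last first.
  by apply/funext => x; rewrite !mxE.
apply: CkM => //.
  apply: CkV => //; last exact: Ck_det.
  by move=> x Ox; rewrite -unitfE -unitmxE fu.
apply: CkM => //; first exact: Ck_cst.
apply: Ck_det => //; apply: Ck_entries => // i' j'.
rewrite (_ : (fun x => _) = fun x => f x (lift j i') (lift i j')).
  exact: Ck_entry.
by apply/funext => x; rewrite !mxE.
Qed.

End MatrixCalculus.

Section BlockMatrices.
Context {R : realType} {V : normedModType R}.
Implicit Types (O : set V) (x v : V).

Lemma Ck_id k O : Ck_on k O (id : V -> V).
Proof.
case: k => [|k] /=; first by move=> x _; exact: cvg_id.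
split=> [x _|v]; first exact: ex_diff.
rewrite (_ : (fun x => 'D_v id x) = fun=> v); first exact: Ck_cst.
by apply/funext => x; rewrite derive_id.
Qed.

Lemma Ck_scale {m n} k O (c : V -> R) (f : V -> 'M[R]_(m, n)) : open O ->
  Ck_on k O c -> Ck_on k O f -> Ck_on k O (fun x => c x *: f x).
Proof.
move=> oO Cc Cf; apply: Ck_entries => // i j.
rewrite (_ : (fun x => (c x *: f x) i j) = fun x => c x * f x i j); last first.
  by apply/funext => x; rewrite mxE.
by apply: CkM => //; exact: Ck_entry.
Qed.

Lemma row_mx_mulE {m n p} (a : 'M[R]_(m, n)) (b : 'M[R]_(m, p)) :
  row_mx a b = a *m row_mx 1%:M 0 + b *m row_mx 0 1%:M.
Proof.
by rewrite !mul_mx_row !mulmx1 !mulmx0 add_row_mx addr0 add0r.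
Qed.

Lemma Ck_mulmxr {m n p} k O (f : V -> 'M[R]_(m, n)) (B : 'M[R]_(n, p)) :
  open O -> Ck_on k O f -> Ck_on k O (fun x => f x *m B).
Proof. by move=> oO Cf; apply: Ck_mulmx => //; exact: Ck_cst. Qed.

Lemma Ck_row_mx {m n p} k O (f : V -> 'M[R]_(m, n)) (g : V -> 'M[R]_(m, p)) :
  open O -> Ck_on k O f -> Ck_on k O g ->
  Ck_on k O (fun x => row_mx (f x) (g x)).
Proof.
move=> oO Cf Cg; rewrite (_ : (fun x => row_mx (f x) (g x)) =
   fun x => f x *m row_mx 1%:M 0 + g x *m row_mx 0 1%:M); last first.
  by apply/funext => x; exact: row_mx_mulE.
by apply: CkD => //; exact: Ck_mulmxr.
Qed.

Lemma differentiable_lin {m n} {W : normedModType R}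
    (L : {linear 'M[R]_(m, n) -> W}) (f : V -> 'M[R]_(m, n)) x :
  differentiable f x -> differentiable (fun y => L (f y)) x.
Proof.
move=> df; apply: (@differentiable_comp _ _ _ _ f L) => //.
exact/linear_differentiable/mx_linear_continuous.
Qed.

Lemma differentiable_row_mx {m n p} (f : V -> 'M[R]_(m, n))
    (g : V -> 'M[R]_(m, p)) x :
  differentiable f x -> differentiable g x ->
  differentiable (fun x => row_mx (f x) (g x)) x.
Proof.
move=> df dg; rewrite (_ : (fun x => row_mx (f x) (g x)) =
   (fun x => f x *m row_mx 1%:M 0) + (fun x => g x *m row_mx 0 1%:M));
  last first.
  by apply/funext => y; exact: row_mx_mulE.
apply: differentiableD.
  exact: (differentiable_lin (mulmxr (row_mx 1%:M 0))).
exact: (differentiable_lin (mulmxr (row_mx 0 1%:M))).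
Qed.

Lemma derive_row_mx {m n p} (f : V -> 'M[R]_(m, n)) (g : V -> 'M[R]_(m, p))
    x v :
  differentiable f x -> differentiable g x ->
  'D_v (fun x => row_mx (f x) (g x)) x = row_mx ('D_v f x) ('D_v g x).
Proof.
move=> df dg.
have dfg := differentiable_row_mx df dg.
apply/matrixP => i j; rewrite -derive_entry; last exact: diff_derivable.
rewrite mxE; case: splitP => l jl.
- rewrite (_ : j = lshift p l); last exact: val_inj.
  rewrite -(derive_entry (f := f)); last exact: diff_derivable.
  by congr ('D_v _ x); apply/funext => y; rewrite row_mxEl.
- rewrite (_ : j = rshift n l); last exact: val_inj.
  rewrite -(derive_entry (f := g)); last exact: diff_derivable.
  by congr ('D_v _ x); apply/funext => y; rewrite row_mxEr.
Qed.

End BlockMatrices.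

Section Smooth.
Context {R : realType} {V : normedModType R}.
Implicit Types (O : set V) (x v : V).

Lemma smooth_differentiable {W : normedModType R} O (f : V -> W) x :
  smooth_on O f -> O x -> differentiable f x.
Proof. by move=> /(_ 1%N) [df _] /df. Qed.

Lemma smooth_derive {W : normedModType R} O (f : V -> W) v :
  smooth_on O f -> smooth_on O (fun x => 'D_v f x).
Proof. by move=> sf k; have [_] := sf k.+1; exact. Qed.

Lemma smooth_continuous {W : normedModType R} O (f : V -> W) x :
  smooth_on O f -> O x -> {for x, continuous f}.
Proof. by move=> /(_ 0%N); exact. Qed.

Lemma open_neq0 (f : V -> R) (A : set V) : open A ->
  (forall u, A u -> {for u, continuous f}) ->
  open [set u | A u /\ f u != 0].
Proof.
move=> oA cf; rewrite openE => u [Au fu].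
have H1 : nbhs u A by exact: open_nbhs_nbhs.
have H2 : nbhs u (f @^-1` [set x | x != 0]).
  by apply: (cf u Au); apply: open_nbhs_nbhs; split => //; exact: open_neq.
exact: filterI H1 H2.
Qed.

End Smooth.

(** * Differentiation along a submanifold *)

(** Joins completeness with the norm, as the fixed point theorem of
    [tangent_approx] requires of the space in which it is applied. *)
HB.instance Definition _ (R : realType) m n := Complete.on 'M[R]_(m, n).

Section Tangent.
Context {R : realType}.

Lemma nbhs_radius {V : normedModType R} (x : V) (A : set V) : nbhs x A ->
  exists2 d : R, 0 < d & forall y, `|y - x| < d -> A y.
Proof.
move=> /nbhs_normP [d d0 dA]; exists d => // y yx; apply: dA => /=.
by rewrite distrC.
Qed.

Lemma le_mx_entry {m n} (A : 'M[R]_(m, n)) i j : `|A i j| <= `|A|.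
Proof.
rewrite [leRHS]/Num.Def.normr /= mx_normrE.
exact: (le_bigmax _ (fun ij : 'I_m * 'I_n => `|A ij.1 ij.2|) (i, j)).
Qed.

Lemma mx_norm_le {m n} (A : 'M[R]_(m, n)) c : 0 <= c ->
  (forall i j, `|A i j| <= c) -> `|A| <= c.
Proof.
move=> c0 Ac; rewrite [leLHS]/Num.Def.normr /= mx_normrE.
by apply: bigmax_le => // ij _; exact: Ac.
Qed.

Lemma derive_coords {n} {W : normedModType R} (f : 'rV[R]_n -> W) x w :
  differentiable f x ->
  'D_w f x = \sum_i w 0 i *: 'D_(delta_mx 0 i) f x.
Proof.
move=> df; rewrite deriveE // [in LHS](row_sum_delta w) linear_sum.
by apply: eq_bigr => i _; rewrite linearZ /= deriveE.
Qed.

(** A C^1 map is strictly differentiable: the mean value theorem, applied to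
    each coordinate of [F] on the segment from [y] to [x], bounds the error by
    the oscillation of the partial derivatives near [m]. *)
Lemma strict_diff {n k} (O : set 'rV[R]_n) (F : 'rV[R]_n -> 'rV[R]_k) m
    (e : R) : open O -> O m -> Ck_on 1 O F -> 0 < e ->
  exists2 d : R, 0 < d & forall x y, `|x - m| < d -> `|y - m| < d ->
    `|F x - F y - 'd F m (x - y)| <= e * `|x - y|.
Proof.
move=> oO Om [dF cF] e0.
(* One more than the number of coordinates, so as not to divide by 0. *)
have e1 : 0 < e / n.+1%:R by rewrite divr_gt0.
have : \forall z \near m, O z /\ forall i,
    `|'D_(delta_mx 0 i) F z - 'D_(delta_mx 0 i) F m| < e / n.+1%:R.
  apply: filterI; first exact: open_nbhs_nbhs.
  have H (i : 'I_n) : \forall z \near m,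
      `|'D_(delta_mx 0 i) F z - 'D_(delta_mx 0 i) F m| < e / n.+1%:R.
    have /cvgrPdist_lt /(_ _ e1) := cF (delta_mx 0 i) m Om.
    by apply: filterS => z; rewrite distrC.
  exact: (filter_forall (nbhs_filter m) H).
move=> /nbhs_radius [d d0 Hd]; exists d => // x y xm ym.
set w := x - y.
apply: mx_norm_le; first by rewrite mulr_ge0 // ltW.
move=> i0 j; rewrite {i0}ord1.
pose z (s : R) : 'rV[R]_n := s *: w + y.
have zm (s : R) : 0 <= s <= 1 -> `|z s - m| < d.
  move=> /andP[s0 s1]; have -> : z s - m = s *: (x - m) + (1 - s) *: (y - m).
    rewrite /z /w !scalerBr scalerBl scale1r scalerBl scale1r.
    by apply/rowP => i; rewrite !mxE; ring.
  apply: le_lt_trans (ler_normD _ _) _; rewrite !normrZ.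
  rewrite ger0_norm // (ger0_norm (x := 1 - s)) ?subr_ge0 //.
  have [->|sn0] := eqVneq s 0; first by rewrite mul0r add0r subr0 mul1r.
  have -> : d = s * d + (1 - s) * d by rewrite -mulrDl subrKC mul1r.
  apply: ltr_leD; first by rewrite ltr_pM2l // lt_neqAle eq_sym sn0.
  by apply: ler_wpM2l; [rewrite subr_ge0|exact: ltW].
pose phi (s : R) : R := F (z s) 0 j.
have dphi (s : R) : 0 <= s <= 1 -> is_derive s 1 phi (('D_w F (z s)) 0 j).
  move=> s01; have [Oz _] := Hd _ (zm _ s01).
  have dz : is_diff s z ( *:%R^~ w).
    have -> : z = ( *:%R^~ w) + cst y by [].
    apply: is_diff_eq.
    by rewrite addr0.
  have dFz : differentiable (F \o z) s.
    by apply: differentiable_comp; [exact: ex_diff|exact: dF].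
  apply: DeriveDef; first exact/diff_derivable/differentiable_entry.
  rewrite /phi (derive_entry (f := F \o z)); last exact: diff_derivable.
  rewrite deriveE // diff_comp; [|exact: ex_diff|exact: dF].
  by rewrite /= diff_val scale1r -deriveE //; exact: dF.
have [c c01 ec] : exists2 c, c \in `[(0 : R), 1]%R &
    phi 1 - phi 0 = ('D_w F (z c)) 0 j * (1 - 0).
  apply: (@MVT_segment R phi (fun s => ('D_w F (z s)) 0 j)) => // [s|].
    by rewrite in_itv /= => /andP[/ltW s0 /ltW s1]; apply: dphi; rewrite s0.
  apply: derivable_within_continuous => s; rewrite in_itv /= => s01.
  by have ? := dphi s s01; exact: ex_derive.
move: c01; rewrite in_itv /= => c01.
have [Oz Hz] := Hd _ (zm _ c01).
have -> : (F x - F y - 'd F m w) 0 j =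
   ('D_w F (z c) - 'D_w F m) 0 j.
  move: ec; rewrite /phi /z scale1r scale0r add0r subr0 mulr1 /w subrK => ec.
  rewrite (deriveE (f := F) (a := m)); last exact: dF.
  by rewrite !mxE -ec.
rewrite !derive_coords; [|exact: dF..].
rewrite -sumrB summxE; apply: le_trans (ler_norm_sum _ _ _) _.
have -> : e * `|w| = \sum_(i < n.+1) (e / n.+1%:R * `|w|).
  rewrite sumr_const card_ord -[RHS]mulr_natr mulrAC divfK // pnatr_eq0.
rewrite big_ord_recr /= -[leLHS]addr0; apply: lerD; last first.
  by rewrite mulr_ge0 // ltW.
apply: ler_sum => i _; rewrite -scalerBr mxE normrM mulrC ler_pM //.
  exact: le_trans (le_mx_entry _ _ _) (ltW (Hz i)).
exact: le_mx_entry.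
Qed.

(** The kernel of the differential lies in the tangent cone of [M]: the point
    [m + t v] is brought back to [M] by a correction [w] that is small with
    respect to [t].  The correction is sought in the range of a right inverse
    [L] of the differential: [m + t v + c L] lies on [M] exactly when [c] is a
    fixed point of [c |-> c - F (m + t v + c L)], and this map is a contraction
    of a small ball because [F] is strictly differentiable at [m]. *)
Lemma tangent_approx {n k} (M O : set 'rV[R]_n) (F : 'rV[R]_n -> 'rV[R]_k) m v :
  local_defining M m O F -> M m -> 'd F m v = 0 ->
  forall e r : R, 0 < e -> 0 < r -> exists t w,
    [/\ 0 < t, t <= r, `|w| <= e * t & M (m + (t *: v + w))].
Proof.
move=> [oO Om sF sur MO] Mm Fv.
have dF : differentiable F m by exact: smooth_differentiable sF Om.
have Fm : F m = 0.
  by have [] : [set x | O x /\ F x = 0] m by rewrite -MO; split.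
have [f Ff] := choice (fun i : 'I_k => sur m Om (delta_mx 0 i)).
pose L : 'M[R]_(k, n) := \matrix_i f i.
have FL c : 'd F m (c *m L) = c.
  rewrite [c in RHS]row_sum_delta mulmx_sum_row linear_sum.
  by apply: eq_bigr => i _; rewrite linearZ /= rowK Ff.
have [K K0 LK] : exists2 K : R, 0 < K &
    forall c : 'rV[R]_k, `|c *m L| <= K * `|c|.
  exact: (linear_lipschitz (f := mulmxr L) (@mx_linear_continuous _ _ _ _ _)).
move=> e r e0 r0.
(* The ball in which [c] is sought has radius [e' t], so that [|c L| <= e t];
   [V t] then bounds the distance from [m] to the points considered. *)
pose e' := e / K.
have e'0 : 0 < e' by rewrite divr_gt0.
pose V := `|v| + e.
have V0 : 0 < V by rewrite ltr_wpDl.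
have K2 : 0 < (2 * K)^-1 by rewrite invr_gt0 mulr_gt0.
(* Accuracy [1 / (2 K)] makes the map a 1/2-contraction; accuracy [e2] makes
   its value at 0 at most half of the radius. *)
pose e2 := e' / (2 * V).
have e20 : 0 < e2 by rewrite divr_gt0 // mulr_gt0.
have [d1 d10 Hd1] := strict_diff oO Om (sF 1%N) K2.
have [d2 d20 Hd2] := strict_diff oO Om (sF 1%N) e20.
have [d3 d30 Hd3] : exists2 d : R, 0 < d & forall y, `|y - m| < d -> O y.
  by apply: nbhs_radius; exact: open_nbhs_nbhs.
pose d := Num.min d1 (Num.min d2 d3).
have d0 : 0 < d by rewrite !lt_min d10 d20.
pose t := Num.min r (d / (2 * V)).
have t0 : 0 < t by rewrite lt_min r0 divr_gt0 // mulr_gt0.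
have tV : t * V < d.
  apply: (@le_lt_trans _ _ (d / (2 * V) * V)).
    by rewrite ler_pM2r // ge_min lexx orbT.
  by rewrite invfM mulrA divfK ?gt_eqF // ltr_pdivrMr // ltr_pMr // ltr1n.
pose U : set 'rV[R]_k := [set c | `|c| <= e' * t].
pose X (c : 'rV[R]_k) := m + (t *: v + c *m L).
have XU c : U c -> `|X c - m| < d.
  move=> Uc; apply: le_lt_trans tV.
  rewrite /X addrC addKr; apply: le_trans (ler_normD _ _) _.
  rewrite normrZ gtr0_norm // /V mulrDr lerD2l.
  apply: le_trans (LK c) _; rewrite -ler_pdivlMl //.
  by apply: le_trans Uc _; rewrite /e' [K^-1 * _]mulrC mulrAC [e * t]mulrC.
have Xd c : U c -> [/\ `|X c - m| < d1, `|X c - m| < d2 & `|X c - m| < d3].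
  by move=> /XU; rewrite !lt_min => /and3P[].
have U0 : U 0 by rewrite /U /= normr0 mulr_ge0 // ltW.
pose G (c : 'rV[R]_k) := c - F (X c).
have GL c c' : U c -> U c' -> `|G c - G c'| <= 2^-1 * `|c - c'|.
  move=> /Xd[Xc _ _] /Xd[Xc' _ _].
  have Xcc' : X c - X c' = (c - c') *m L.
    rewrite /X mulmxBl; move: (c *m L) (c' *m L) => A B.
    by apply/rowP => i; rewrite !mxE; ring.
  have -> : G c - G c' = - (F (X c) - F (X c') - 'd F m (X c - X c')).
    rewrite Xcc' FL /G; apply/rowP => i; rewrite !mxE; ring.
  rewrite normrN; apply: le_trans (Hd1 _ _ Xc Xc') _; rewrite Xcc'.
  rewrite invfM -mulrA ler_pM2l ?invr_gt0 //.
  by rewrite ler_pdivrMl.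
have G0 : `|G 0| <= 2^-1 * (e' * t).
  have [_ Xc _] := Xd 0 U0.
  have mm : `|m - m| < d2 by rewrite subrr normr0.
  have := Hd2 _ _ Xc mm.
  rewrite /X mul0mx addr0 (addrC m) addrK Fm subr0 linearZ /= Fv scaler0 subr0.
  rewrite /G /X mul0mx addr0 sub0r normrN (addrC m) => /le_trans; apply.
  rewrite normrZ gtr0_norm // /e2 invfM.
  have -> : e' * (2^-1 / V) * (t * `|v|) = 2^-1 * (e' * t) * (`|v| / V) by ring.
  rewrite ler_piMr // ?mulr_ge0 ?invr_ge0 ?ltW //.
  by rewrite ltr_pdivrMr // mul1r ltrDl.
have GU : {homo G : c / U c >-> U c}.
  move=> c Uc; rewrite /U /=.
  rewrite -(subrK (G 0) (G c)); apply: le_trans (ler_normD _ _) _.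
  have -> : e' * t = 2^-1 * (e' * t) + 2^-1 * (e' * t).
    by rewrite -mulrDl -div1r -splitr mul1r.
  apply: lerD => //; apply: le_trans (GL _ _ Uc U0) _.
  by rewrite subr0 ler_pM2l // invr_gt0.
have [c Uc cG] : exists2 c, U c & c = mkfun_fun GU c.
  apply: banach_fixed_point.
  - exists (2^-1)%:nng; split => /=; first by rewrite invf_lt1 // ltr1n.
    by move=> [c c'] [/= Uc Uc']; exact: GL.
  - rewrite (_ : U = (fun c : 'rV[R]_k => `|c|) @^-1` [set x | x <= e' * t]) //.
    by apply: closed_comp => [c _|]; [exact: norm_continuous|exact: closed_le].
  - by exists 0.
have FX : F (X c) = 0.
  move: cG; rewrite /= /mkfun /G => /eqP.
  by rewrite eq_sym subr_eq addrC -subr_eq subrr => /eqP.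
exists t, (c *m L); split => //.
- by rewrite ge_min lexx.
- apply: le_trans (LK c) _; rewrite -ler_pdivlMl //.
  by apply: le_trans Uc _; rewrite /e' [K^-1 * _]mulrC mulrAC.
- have [_ _ /Hd3 OX] := Xd c Uc.
  suff : (M `&` O) (X c) by case.
  by rewrite MO.
Qed.

(** This is why the derivative at [m], along a tangent vector, of a function
    given on [M] does not depend on how it is extended off [M]: two extensions
    differ by a function [h] as below.  Points of [M] approach [m] in the
    direction [v] by [tangent_approx], and [h] is 0 at all of them. *)
Lemma derive_vanishing {n} {W : normedModType R} (M O : set 'rV[R]_n)
    (h : 'rV[R]_n -> W) m v :
  M m -> tangent M m v -> open O -> O m -> differentiable h m ->
  (forall x, M x -> O x -> h x = 0) -> 'D_v h m = 0.
Proof.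
move=> Mm [k [D [F [lF Fv]]]] oO Om dh h0; rewrite deriveE //.
have [B B0 hB] := linear_lipschitz (@diff_continuous _ _ _ (nbhs m) h dh).
apply/eqP; rewrite -normr_le0; apply/ler_addgt0Pr => e e0; rewrite add0r.
pose a := e / (B + `|v| + 1).
have D0 : 0 < B + `|v| + 1 by rewrite ltr_pwDr // addr_ge0 // ltW.
have a0 : 0 < a by rewrite divr_gt0.
pose b := Num.min a 1.
have b0 : 0 < b by rewrite lt_min a0 ltr01.
have [d d0 Hd] : exists2 d : R, 0 < d & forall y, `|y - m| < d ->
    O y /\ `|h y - h m - 'd h m (y - m)| <= a * `|y - m|.
  have H : \forall y \near m, `|h y - h m - 'd h m (y - m)| <= a * `|y - m|.
    have /eqaddoP /(_ a a0) /nbhs_radius [r r0 Hr] := diff_locally dh.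
    apply/nbhs_normP; exists r => // y /=; rewrite distrC => ymr.
    have /Hr : `|(y - m) - 0| < r by rewrite subr0.
    by rewrite !fctE /= subrK opprD addrA.
  apply: nbhs_radius; apply: filterI H; exact: open_nbhs_nbhs.
have [t [w [t0 tr wt Mw]]] := tangent_approx lF Mm Fv b0
  (divr_gt0 d0 (ltac:(by rewrite mulr_gt0) : 0 < 2 * (`|v| + 1))).
have wt' : `|w| <= a * t.
  by apply: le_trans wt _; rewrite ler_pM2r // ge_min lexx.
have wt1 : `|w| <= t.
  by apply: le_trans wt _; rewrite ler_piMl ?ge_min ?lexx ?orbT // ltW.
have nx : `|t *: v + w| <= t * (`|v| + 1).
  apply: le_trans (ler_normD _ _) _.
  by rewrite normrZ gtr0_norm // mulrDr mulr1 lerD2l.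
have xm : m + (t *: v + w) - m = t *: v + w by rewrite addrC addKr.
have [|Ox Hx] := Hd (m + (t *: v + w)).
  rewrite xm; apply: le_lt_trans nx _.
  apply: (@le_lt_trans _ _ (d / (2 * (`|v| + 1)) * (`|v| + 1))).
    by rewrite ler_pM2r // ltr_wpDl.
  rewrite invfM mulrA divfK ?gt_eqF ?ltr_wpDl //.
  by rewrite ltr_pdivrMr // ltr_pMr // ltr1n.
move: Hx; rewrite xm !h0 // sub0r oppr0 add0r normrN linearD linearZ /= => Hx.
have : t * `|'d h m v| <= t * e.
  rewrite -[X in X * _]gtr0_norm // -normrZ -(addrK ('d h m w) (t *: _)).
  apply: le_trans (ler_normB _ _) _.
  apply: (@le_trans _ _ (a * (t * (`|v| + 1)) + B * (a * t))).
    apply: lerD; first by apply: le_trans Hx _; rewrite ler_pM2l.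
    by apply: le_trans (hB w) _; rewrite ler_pM2l.
  have -> : a * (t * (`|v| + 1)) + B * (a * t) =
      t * (a * (B + `|v| + 1)) by ring.
  by rewrite /a divfK ?gt_eqF.
by rewrite ler_pM2l.
Qed.

End Tangent.

Section Mderive.
Context {R : realType}.

(** The derivative chosen by [mderive] may come from another extension than
    [g]; [derive_vanishing] identifies the two. *)
Lemma mderiveE {n} {W : normedModType R} (M O : set 'rV[R]_n)
    (f g : 'rV[R]_n -> W) m v :
  M m -> tangent M m v -> open O -> O m -> smooth_on O g ->
  (forall x, M x -> O x -> g x = f x) -> mderive M f m v = 'D_v g m.
Proof.
move=> Mm tv oO Om sg gf; rewrite /mderive.
case: xgetP => [w _|/(_ ('D_v g m)) []]; last by exists O, g.
move=> [ O' [g' [oO' O'm sg' gf' ->]]].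
have dg := smooth_differentiable sg Om.
have dg' := smooth_differentiable sg' O'm.
apply/eqP; rewrite -subr_eq0; apply/eqP.
rewrite -deriveB; [|exact: diff_derivable..].
apply: (@derive_vanishing _ _ _ M (O `&` O')) => //.
- exact: openI.
- exact: differentiableB.
- by move=> x Mx [Ox O'x]; rewrite !fctE /= gf // gf' // subrr.
Qed.

End Mderive.

(** * Euclidean linear algebra *)

Section Euclidean.
Context {R : realType}.

Lemma gram_eq0 {m n} (A : 'M[R]_(m, n)) : A *m A^T = 0 -> A = 0.
Proof.
move=> AA; apply/matrixP => i j.
have /eqP : (A *m A^T) i i = 0 by rewrite AA mxE.
rewrite !mxE psumr_eq0; last by move=> l _; rewrite mxE -expr2 sqr_ge0.
by move=> /allP /(_ j (mem_index_enum _)); rewrite mxE mulf_eq0 orbb => /eqP.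
Qed.

Lemma dotBl {n} (u v w : 'rV[R]_n) : dot (u - v) w = dot u w - dot v w.
Proof. by rewrite /dot mulmxBl !mxE. Qed.

Lemma dot_ge0 {n} (a : 'rV[R]_n) : 0 <= dot a a.
Proof. by rewrite /dot mxE sumr_ge0 // => i _; rewrite mxE -expr2 sqr_ge0. Qed.

(** Polarization: a symmetric matrix whose quadratic form vanishes is 0. *)
Lemma isometry_gram {d n} (g : 'M[R]_(d, n)) :
  (forall a, enorm (a *m g) = enorm a) <-> g *m g^T = 1%:M.
Proof.
split=> [eg|gg a]; last first.
  by rewrite /enorm /dot trmx_mul mulmxA -(mulmxA a) gg mulmx1.
set B := g *m g^T - 1%:M.
pose b (x y : 'rV[R]_d) := (x *m B *m y^T) 0 0.
have q0 a : b a a = 0.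
  have := congr1 (fun x => x ^+ 2) (eg a).
  rewrite /enorm !sqr_sqrtr ?dot_ge0 // /dot trmx_mul => ega.
  rewrite /b /B mulmxBr mulmxBl mulmx1 mxE [X in _ + X]mxE -ega.
  by rewrite !mulmxA subrr.
have BT : B^T = B by rewrite /B linearB /= trmx_mul trmxK trmx1.
suff B0 : B = 0 by apply/eqP; rewrite -subr_eq0 -/B B0.
have Bij i j : b (delta_mx 0 i) (delta_mx 0 j) = B i j.
  by rewrite /b -rowE trmx_delta -colE !mxE.
have bDl x y z : b (x + y) z = b x z + b y z by rewrite /b !mulmxDl mxE.
have bDr x y z : b z (x + y) = b z x + b z y.
  by rewrite /b [(x + y)^T]linearD mulmxDr mxE.
apply/matrixP => i j; rewrite [RHS]mxE.
have := q0 (delta_mx 0 i + delta_mx 0 j).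
have Bji : B j i = B i j by rewrite -[in LHS]BT [LHS]mxE.
rewrite bDl !bDr !q0 !Bij addr0 add0r Bji -mulr2n => /eqP.
by rewrite mulrn_eq0 => /eqP.
Qed.

End Euclidean.

Section SymmetricMatrices.
Context {R : realType} {d : nat}.

(** The map [g |-> g g^T - 1] defining the isometries takes symmetric values, so
    it cannot be a submersion onto all matrices when [d > 1].  The row space of [symmetrizer] is the
    space of (vectorized) symmetric matrices, and multiplication by [sym_coord]
    gives coordinates on it. *)
Definition symmetrizer : 'M[R]_(d * d) := 1%:M + lin_mx (@trmx R d d).
Definition sym_coord : 'M[R]_(d * d, \rank symmetrizer) :=
  pinvmx (row_base symmetrizer).

Lemma mul_symmetrizer (X : 'M[R]_d) : mxvec X *m symmetrizer = mxvec (X + X^T).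
Proof. by rewrite mulmxDr mulmx1 mul_vec_lin linearD. Qed.

Lemma sym_coord_eq0 (X : 'M[R]_d) :
  X^T = X -> mxvec X *m sym_coord = 0 -> X = 0.
Proof.
move=> XT X0; have XE : mxvec X = mxvec (2^-1 *: X) *m symmetrizer.
  rewrite mul_symmetrizer linearZ /= XT -scalerDl -[2^-1]div1r -splitr.
  by rewrite scale1r.
have XS : (mxvec X <= row_base symmetrizer)%MS.
  by rewrite eq_row_base XE submxMl.
apply: (can_inj mxvecK); rewrite linear0.
by rewrite -(mulmxKpV XS) -/sym_coord X0 mul0mx.
Qed.

Lemma sym_coord_surj (c : 'rV[R]_(\rank symmetrizer)) :
  exists X : 'M[R]_d, mxvec (X + X^T) *m sym_coord = c.
Proof.
have /submxP [x cx] : (c *m row_base symmetrizer <= symmetrizer)%MS.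
  by rewrite -(eq_row_base symmetrizer) submxMl.
exists (vec_mx x); rewrite -mul_symmetrizer vec_mxK -cx /sym_coord.
by rewrite mulmxKp // row_base_free.
Qed.

End SymmetricMatrices.

(** * The normal projection of a submanifold *)

Section LocalGeometry.
Context {R : realType} {n k : nat}.
Variables (M : set 'rV[R]_n) (m0 : 'rV[R]_n) (O : set 'rV[R]_n).
Variable (F : 'rV[R]_n -> 'rV[R]_k).
Hypothesis lF : local_defining M m0 O F.

Definition jac x : 'M[R]_(n, k) := \matrix_i 'D_(delta_mx 0 i) F x.
Definition jac_gram x : 'M[R]_k := (jac x)^T *m jac x.
Definition jac_linv x : 'M[R]_(k, n) := invmx (jac_gram x) *m (jac x)^T.
(** The orthogonal projection onto the range of the transposed differential of
    [F].  On [M] it is the projection [projQ M] onto the normal space; unlike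
    [projQ M] it is smooth on a full neighbourhood. *)
Definition normal_proj x : 'M[R]_n := jac x *m jac_linv x.

Let oO : open O. Proof. by case: lF. Qed.
Let sF : smooth_on O F. Proof. by case: lF. Qed.
Let dF x : O x -> differentiable F x.
Proof. exact: smooth_differentiable sF. Qed.

Lemma mul_jac x v : O x -> v *m jac x = 'D_v F x.
Proof.
move=> Ox; rewrite derive_coords ?mulmx_sum_row; last exact: dF.
by apply: eq_bigr => i _; rewrite rowK.
Qed.

Lemma smooth_jac : smooth_on O jac.
Proof.
move=> l; apply: Ck_entries => // i j.
rewrite (_ : (fun x => _) = fun x => ('D_(delta_mx 0 i) F x) 0 j); last first.
  by apply/funext => x; rewrite mxE.
by apply: Ck_entry => //; exact: smooth_derive.
Qed.

(** If [K] kills [J^T J], then [(K J^T) (K J^T)^T = 0], hence [K J^T = 0], and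
    the surjectivity of the differential gives [K = 0]. *)
Lemma jac_gram_unit x : O x -> jac_gram x \in unitmx.
Proof.
move=> Ox; have [_ _ _ sur _] := lF.
have [f Ff] := choice (fun i : 'I_k => sur x Ox (delta_mx 0 i)).
have LJ : (\matrix_i f i) *m jac x = 1%:M.
  apply/row_matrixP => i.
  by rewrite row_mul rowK mul_jac // deriveE ?Ff ?row1 //; exact: dF.
rewrite -row_free_unit -kermx_eq0; apply/eqP.
have := mulmx_ker (jac_gram x); set K := kermx _; rewrite /jac_gram => KJJ.
have KJ : K *m (jac x)^T = 0.
  by apply: gram_eq0; rewrite trmx_mul trmxK !mulmxA -(mulmxA K) KJJ mul0mx.
by rewrite -[K]mulmx1 -trmx1 -LJ trmx_mul mulmxA KJ mul0mx.
Qed.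

Lemma smooth_normal_proj : smooth_on O normal_proj.
Proof.
move=> l; have CJ := smooth_jac l.
have CJT : Ck_on l O (fun x => (jac x)^T).
  by apply: (Ck_lin (L := trmx)) => //; exact: mx_linear_continuous.
apply: Ck_mulmx => //; apply: Ck_mulmx => //; apply: Ck_invmx => //.
  exact: jac_gram_unit.
exact: Ck_mulmx.
Qed.

Lemma jac_linv_jac x : O x -> jac_linv x *m jac x = 1%:M.
Proof. by move=> Ox; rewrite /jac_linv -mulmxA mulVmx // jac_gram_unit. Qed.

Lemma normal_proj_jac x : O x -> normal_proj x *m jac x = jac x.
Proof. by move=> Ox; rewrite /normal_proj -mulmxA jac_linv_jac // mulmx1. Qed.

Lemma trmx_normal_proj x : (normal_proj x)^T = normal_proj x.
Proof.
rewrite /normal_proj /jac_linv !trmx_mul trmxK trmx_inv mulmxA.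
by rewrite /jac_gram trmx_mul trmxK.
Qed.

Lemma normal_proj_idem x :
  O x -> normal_proj x *m normal_proj x = normal_proj x.
Proof. by move=> Ox; rewrite {2}/normal_proj mulmxA normal_proj_jac. Qed.

Lemma normal_proj_eq0 x p (v : 'M[R]_(p, n)) : O x ->
  (v *m normal_proj x = 0) <-> (v *m jac x = 0).
Proof.
move=> Ox; split=> [vQ|vJ].
  by rewrite -normal_proj_jac // mulmxA vQ mul0mx.
by rewrite /normal_proj mulmxA vJ mul0mx.
Qed.

(** A tangent vector may be certified by another local defining map than [F];
    but [F] vanishes on [M], so its derivative along that vector is 0. *)
Lemma tangentE x v : M x -> O x -> tangent M x v <-> v *m jac x = 0.
Proof.
move=> Mx Ox; split => [tv|vJ]; last first.
  exists k, O, F; split; first by case: lF.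
  by rewrite -deriveE ?mul_jac // -?mul_jac //; exact: dF.
rewrite mul_jac //; apply: (derive_vanishing Mx tv oO Ox); first exact: dF.
move=> y My Oy; have [_ _ _ _ MO] := lF.
by have [] : [set x | O x /\ F x = 0] y by rewrite -MO.
Qed.

(** Orthogonal projection onto a subspace is unique: the images [a] and [b] of
    [z] under two of them have a difference that is both in the subspace and
    orthogonal to it. *)
Lemma projPE x : M x -> O x -> projP M x = 1%:M - normal_proj x.
Proof.
move=> Mx Ox; rewrite /projP /orth_proj.
have tP z : tangent M x (z *m (1%:M - normal_proj x)).
  apply/tangentE => //.
  by rewrite -mulmxA mulmxBl mul1mx normal_proj_jac // subrr mulmx0.
have nP z w : tangent M x w -> dot (z - z *m (1%:M - normal_proj x)) w = 0.
  move=> /(tangentE _ Mx Ox) /(normal_proj_eq0 _ Ox) wQ.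
  rewrite mulmxBr mulmx1 opprB addrC subrK /dot -mulmxA.
  by rewrite -[normal_proj x]trmx_normal_proj -trmx_mul wQ trmx0 mulmx0 mxE.
apply: xget_unique => /=; first by move=> z; split; [exact: tP|exact: nP].
move=> A HA; apply/row_matrixP => i; rewrite !rowE.
set z := delta_mx 0 i; set a := z *m A; set b := z *m _.
have [tA nA] := HA z.
have tab : tangent M x (a - b).
  apply/tangentE => //; rewrite mulmxBl.
  move/(tangentE _ Mx Ox) : tA => ->.
  by move/(tangentE _ Mx Ox) : (tP z) => ->; rewrite subrr.
have : dot (a - b) (a - b) = 0.
  have e : a - b = (z - b) - (z - a) by rewrite opprB [RHS]addrC addrA subrK.
  by rewrite {1}e dotBl nP // nA // subrr.
rewrite /dot => ab; apply/eqP; rewrite -subr_eq0; apply/eqP; apply: gram_eq0.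
by apply/matrixP => i0 j0; rewrite !ord1 ab mxE.
Qed.

Lemma projQE x : M x -> O x -> projQ M x = normal_proj x.
Proof. by move=> Mx Ox; rewrite /projQ projPE // opprB addrC subrK. Qed.

Lemma dQE x v : M x -> O x -> v *m jac x = 0 -> dQ M x v = 'D_v normal_proj x.
Proof.
move=> Mx Ox vJ; apply: (@mderiveE _ _ _ M O) => //; first exact/tangentE.
  exact: smooth_normal_proj.
by move=> y My Oy; rewrite projQE.
Qed.

(** This identity and the next differentiate [Q J = J] and [Q Q = Q].  They
    express that the horizontal lift of a tangent vector preserves the two
    conditions defining a frame, see [lift_tangent]. *)
Lemma derive_normal_proj_jac x v : O x ->
  'D_v normal_proj x *m jac x + normal_proj x *m 'D_v jac x = 'D_v jac x.
Proof.
move=> Ox; have dQx := smooth_differentiable smooth_normal_proj Ox.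
have dJ := smooth_differentiable smooth_jac Ox.
rewrite -derive_mulmx //; apply: near_eq_derive.
by apply: (filterS normal_proj_jac); exact: open_nbhs_nbhs.
Qed.

Lemma derive_normal_proj_idem x v : O x ->
  'D_v normal_proj x *m normal_proj x + normal_proj x *m 'D_v normal_proj x =
  'D_v normal_proj x.
Proof.
move=> Ox; have dQx := smooth_differentiable smooth_normal_proj Ox.
rewrite -derive_mulmx //; apply: near_eq_derive.
by apply: (filterS normal_proj_idem); exact: open_nbhs_nbhs.
Qed.

End LocalGeometry.

(** * The orthonormal frame bundle *)

Section FrameCoords.
Context {R : realType} {n d : nat}.
Implicit Types u v : 'rV[R]_(n + d * n).

Lemma frame_pairE (a : 'rV[R]_n) (b : 'M[R]_(d, n)) :
  frame_pair a b = a *m row_mx 1%:M 0 + mxvec b *m row_mx 0 1%:M.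
Proof. exact: row_mx_mulE. Qed.

Lemma frame_pi_pair (a : 'rV[R]_n) (b : 'M[R]_(d, n)) :
  frame_pi (frame_pair a b) = a.
Proof. exact: row_mxKl. Qed.

Lemma frame_map_pair (a : 'rV[R]_n) (b : 'M[R]_(d, n)) :
  frame_map (frame_pair a b) = b.
Proof. by rewrite /frame_map row_mxKr mxvecK. Qed.

(** The differential of the projection [frame_pi], which is linear, as a
    one-form: the matrix is constant. *)
Definition frame_pi_mx : 'M[R]_(n + d * n, n) := col_mx 1%:M 0.

Lemma mul_frame_pi_mx u : u *m frame_pi_mx = frame_pi u.
Proof.
by rewrite /frame_pi_mx -[in LHS](hsubmxK u) mul_row_col mulmx1 mulmx0 addr0.
Qed.

Lemma frame_pi_linear : linear (@frame_pi R n d).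
Proof. by move=> a u v; rewrite -!mul_frame_pi_mx mulmxDl -scalemxAl. Qed.
HB.instance Definition _ := GRing.isLinear.Build R _ _ _ (@frame_pi R n d)
  frame_pi_linear.

Lemma frame_map_linear : linear (@frame_map R n d).
Proof.
move=> a u v; rewrite /frame_map.
by rewrite linearP /= linearP.
Qed.
HB.instance Definition _ := GRing.isLinear.Build R _ _ _ (@frame_map R n d)
  frame_map_linear.

Lemma continuous_frame_pi : continuous (@frame_pi R n d).
Proof. exact: mx_linear_continuous. Qed.

Lemma continuous_frame_map : continuous (@frame_map R n d).
Proof. exact: mx_linear_continuous. Qed.

Lemma Ck_frame_map l (O : set 'rV[R]_(n + d * n)) :
  open O -> Ck_on l O (@frame_map R n d).
Proof.
move=> oO; apply: (Ck_lin (L := @frame_map R n d) (f := id)) => //.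
  exact: continuous_frame_map.
exact: Ck_id.
Qed.

End FrameCoords.

Section FrameGeometry.
Context {R : realType} {n k d : nat}.
Variables (M : set 'rV[R]_n) (m0 : 'rV[R]_n) (O : set 'rV[R]_n).
Variable (F : 'rV[R]_n -> 'rV[R]_k).
Hypothesis lF : local_defining M m0 O F.
Notation D := (n + d * n)%N.
Implicit Type u : 'rV[R]_D.
Notation Q := (normal_proj F).
Notation J := (jac F).
Notation pi_ := (@frame_pi R n d).
Notation g_ := (@frame_map R n d).
Let oO : open O. Proof. by case: lF. Qed.
Let sQ : smooth_on O Q. Proof. exact: smooth_normal_proj lF. Qed.
Let sJ : smooth_on O J. Proof. exact: smooth_jac lF. Qed.
Let dQx x : O x -> differentiable Q x.
Proof. exact: smooth_differentiable. Qed.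

(** The horizontal lift at the frame [u], as the matrix of a linear map: row
    [i] is the lift of [V_z] for [z] the [i]-th basis vector.  With the smooth
    projection [Q] in place of [projQ M] the formula makes sense near the frame
    bundle, and so provides smooth extensions of [Vlift M] and [Blift M]. *)
Definition lift_mx u : 'M[R]_(n, D) :=
  \matrix_i frame_pair (row i (1%:M - Q (pi_ u)))
    (- (g_ u *m 'D_(row i (1%:M - Q (pi_ u))) Q (pi_ u))).

Lemma mul_lift_mx w u : O (pi_ u) -> w *m lift_mx u =
  frame_pair (w *m (1%:M - Q (pi_ u)))
    (- (g_ u *m 'D_(w *m (1%:M - Q (pi_ u))) Q (pi_ u))).
Proof.
move=> Ou; rewrite mulmx_sum_row; set A := 1%:M - _.
under eq_bigr do rewrite rowK frame_pairE scalerDr !scalemxAl.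
rewrite big_split /= -!mulmx_suml frame_pairE.
rewrite -mulmx_sum_row; congr (_ + mulmx _ _).
rewrite deriveE; last exact: dQx.
rewrite [X in 'd _ _ X]mulmx_sum_row linear_sum mulmx_sumr -sumrN linear_sum.
apply: eq_bigr => i _ /=; rewrite [in RHS]linearZ /= -scalemxAr -scalerN.
by rewrite [RHS]linearZ /= deriveE //; exact: dQx.
Qed.

Lemma smooth_lift_mx : smooth_on (pi_ @^-1` O) lift_mx.
Proof.
move=> l; have oO' : open (pi_ @^-1` O).
  by apply: open_comp => // x _; exact: continuous_frame_pi.
have CQ : Ck_on l (pi_ @^-1` O) (fun u => Q (pi_ u)).
  by apply: Ck_comp_lin => //; exact: continuous_frame_pi.
have CP : Ck_on l (pi_ @^-1` O) (fun u => 1%:M - Q (pi_ u)).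
  by apply: CkD => //; [exact: Ck_cst|exact: CkN].
apply: Ck_entries => // i j.
apply: (@Ck_ext _ _ _ _ _ (fun u => (frame_pair (row i (1%:M - Q (pi_ u)))
    (- (g_ u *m \sum_q (1%:M - Q (pi_ u)) i q *:
       'D_(delta_mx 0 q) Q (pi_ u)))) 0 j)) => //.
  move=> u Ou; rewrite [RHS]mxE derive_coords; last exact: dQx.
  congr (fun_of_matrix (frame_pair _ (- mulmx _ _)) _ _).
  by apply: eq_bigr => q _; rewrite [in RHS]mxE.
apply: Ck_entry => //; apply: Ck_row_mx => //.
  apply: Ck_entries => // i' j'.
  rewrite (_ : (fun u => _) = fun u => (1%:M - Q (pi_ u)) i j'); last first.
    by apply/funext => u; rewrite mxE.
  exact: Ck_entry.
apply: Ck_lin => //; first exact: mx_linear_continuous.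
apply: CkN => //; apply: Ck_mulmx => //; first exact: Ck_frame_map.
apply: Ck_sum => // q _; apply: Ck_scale => //; first exact: Ck_entry.
apply: (Ck_comp_lin (f := fun x => 'D_(delta_mx 0 q) Q x)) => //.
  exact: continuous_frame_pi.
exact: smooth_derive.
Qed.

Lemma Vlift_mul b u : M (pi_ u) -> O (pi_ u) -> Vlift M b u = b *m lift_mx u.
Proof.
move=> Mu Ou; rewrite mul_lift_mx // /Vlift /hlift /Vfield (projPE lF) //.
rewrite (dQE lF) // -mulmxA mulmxBl mul1mx (normal_proj_jac lF) //.
by rewrite subrr mulmx0.
Qed.

Lemma frame_map_jac u : frame_bundle M u -> O (pi_ u) -> g_ u *m J (pi_ u) = 0.
Proof.
move=> [Mu tu] Ou; apply/row_matrixP => i; rewrite row_mul row0 rowE.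
by have [/(tangentE lF _ Mu Ou)] := tu (delta_mx 0 i).
Qed.

Lemma frame_map_normal_proj u :
  frame_bundle M u -> O (pi_ u) -> g_ u *m Q (pi_ u) = 0.
Proof.
by move=> Fu Ou; apply/(normal_proj_eq0 lF) => //; exact: frame_map_jac.
Qed.

(** The three components vanish when the base point is on [M], when the frame
    takes tangent values, and when it is isometric; together they form a local
    defining map of the frame bundle. *)
Definition frame_eqn u :
    'rV[R]_(k + (d * k + \rank (symmetrizer : 'M[R]_(d * d)))) :=
  row_mx (F (pi_ u)) (row_mx (mxvec (g_ u *m J (pi_ u)))
    (mxvec (g_ u *m (g_ u)^T - 1%:M) *m sym_coord)).

(** The determinant is that of the Gram matrix of the tangential part of the
    frame.  It is 1 on the frame bundle, and [frame_eqn] is a submersion where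
    it does not vanish. *)
Definition frame_dom : set 'rV[R]_D :=
  [set u | O (pi_ u) /\
     \det (g_ u *m (1%:M - Q (pi_ u)) *m (g_ u)^T) != 0].

Let dF x : O x -> differentiable F x.
Proof. by case: lF => _ _ sF _ _; exact: smooth_differentiable sF. Qed.
Let dJ x : O x -> differentiable J x.
Proof. exact: smooth_differentiable. Qed.

Lemma differentiable_comp_pi {W : normedModType R} (f : 'rV[R]_n -> W) u :
  differentiable f (pi_ u) -> differentiable (fun u => f (pi_ u)) u.
Proof.
move=> df; apply: differentiable_comp => //.
exact/linear_differentiable/continuous_frame_pi.
Qed.

Lemma differentiable_frame_map u : differentiable g_ u.
Proof. exact/linear_differentiable/continuous_frame_map. Qed.

Lemma derive_frame_map u v : 'D_v g_ u = g_ v.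
Proof.
rewrite deriveE; last exact: differentiable_frame_map.
by rewrite diff_lin //; exact: continuous_frame_map.
Qed.

Lemma derive_frame_eqn u v : O (pi_ u) -> 'D_v frame_eqn u =
  row_mx ('D_(pi_ v) F (pi_ u))
    (row_mx (mxvec (g_ v *m J (pi_ u) + g_ u *m 'D_(pi_ v) J (pi_ u)))
      (mxvec (g_ v *m (g_ u)^T + g_ u *m (g_ v)^T) *m sym_coord)).
Proof.
move=> Ou; have dg := differentiable_frame_map u.
have dFp := differentiable_comp_pi (dF Ou).
have dJp := differentiable_comp_pi (dJ Ou).
have dgJ := differentiable_mulmx dg dJp.
have dgT : differentiable (fun u => (g_ u)^T) u.
  exact: (differentiable_lin trmx).
have dgg := differentiable_mulmx dg dgT.
have dgg1 : differentiable (fun u => g_ u *m (g_ u)^T - 1%:M) u.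
  by apply: differentiableB => //; exact: differentiable_cst.
have d2 : differentiable (fun u => mxvec (g_ u *m J (pi_ u))) u.
  exact: (differentiable_lin mxvec).
have d3' : differentiable (fun u => mxvec (g_ u *m (g_ u)^T - 1%:M)) u.
  exact: (differentiable_lin mxvec dgg1).
have d3 : differentiable
    (fun u => mxvec (g_ u *m (g_ u)^T - 1%:M) *m sym_coord) u.
  exact: (differentiable_lin (mulmxr sym_coord) d3').
rewrite /frame_eqn derive_row_mx //; last exact: differentiable_row_mx.
rewrite derive_row_mx //.
rewrite (derive_comp_lin (L := pi_)) //;
  [|exact: continuous_frame_pi|exact: dF].
rewrite (derive_lin (L := mxvec)) //; last exact: mx_linear_continuous.
rewrite (derive_lin (L := mulmxr sym_coord)) //;
  last exact: mx_linear_continuous.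
rewrite (derive_lin (L := mxvec)) //; last exact: mx_linear_continuous.
rewrite derive_mulmx // derive_frame_map.
rewrite (derive_comp_lin (L := pi_)) //;
  [|exact: continuous_frame_pi|exact: dJ].
rewrite deriveB; [|exact: diff_derivable|exact: derivable_cst].
rewrite derive_cst subr0 derive_mulmx // derive_frame_map.
rewrite (derive_lin (L := trmx)) //; last exact: mx_linear_continuous.
by rewrite derive_frame_map.
Qed.

Let oO' : open (pi_ @^-1` O).
Proof. by apply: open_comp => // x _; exact: continuous_frame_pi. Qed.

Lemma Ck_Q_pi l : Ck_on l (pi_ @^-1` O) (fun u => Q (pi_ u)).
Proof. by apply: Ck_comp_lin => //; exact: continuous_frame_pi. Qed.

Lemma Ck_frame_map_tr l : Ck_on l (pi_ @^-1` O) (fun u => (g_ u)^T).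
Proof.
apply: (Ck_lin (L := trmx) (f := g_)); last exact: Ck_frame_map.
  exact: mx_linear_continuous.
exact: oO'.
Qed.

Lemma Ck_frame_det l : Ck_on l (pi_ @^-1` O)
  (fun u => \det (g_ u *m (1%:M - Q (pi_ u)) *m (g_ u)^T)).
Proof.
apply: Ck_det; first exact: oO'.
apply: Ck_mulmx; [exact: oO'| |exact: Ck_frame_map_tr].
apply: Ck_mulmx; [exact: oO'|exact: Ck_frame_map|].
apply: CkD; [exact: oO'|exact: Ck_cst|].
by apply: CkN; [exact: oO'|exact: Ck_Q_pi].
Qed.

Lemma open_frame_dom : open frame_dom.
Proof.
apply: open_neq0; first exact: oO'.
by move=> u Ou; exact: (Ck_frame_det 0).
Qed.

Lemma smooth_frame_eqn : smooth_on frame_dom frame_eqn.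
Proof.
move=> l; apply: (@Ck_sub _ _ _ _ (pi_ @^-1` O)); first by move=> u [].
have Cg := Ck_frame_map (d := d) l oO'.
apply: Ck_row_mx => //.
  apply: Ck_comp_lin => //; first exact: continuous_frame_pi.
  by case: lF => _ _ sF _ _; exact: sF.
apply: Ck_row_mx => //.
  apply: Ck_lin => //; first exact: mx_linear_continuous.
  apply: Ck_mulmx => //; apply: Ck_comp_lin => //; exact: continuous_frame_pi.
apply: Ck_mulmxr => //; apply: Ck_lin => //; first exact: mx_linear_continuous.
apply: CkD => //; last exact: Ck_cst.
apply: Ck_mulmx => //.
by apply: (Ck_lin (L := trmx)) => //; exact: mx_linear_continuous.
Qed.

Lemma frame_bundle_dom u : frame_bundle M u -> O (pi_ u) -> frame_dom u.
Proof.
move=> Fu Ou; split=> //; rewrite mulmxBr mulmx1 frame_map_normal_proj // subr0.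
have -> : g_ u *m (g_ u)^T = 1%:M.
  by apply/isometry_gram => a; have [_ /(_ a) []] := Fu.
by rewrite det1 oner_eq0.
Qed.

(** Given a target [(a, B, c)], the first component fixes the variation of the
    base point.  The normal part [h1] of the variation of the frame then solves
    the second component, and its tangential part [A (g P)], invisible to the
    second component, is adjusted to solve the third. *)
Lemma frame_eqn_submersion u w : frame_dom u -> exists v, 'd frame_eqn u v = w.
Proof.
move=> [Ou /=]; set P := 1%:M - Q (pi_ u); set g := g_ u => G0.
have dfF : differentiable frame_eqn u.
  apply: (smooth_differentiable smooth_frame_eqn); split => //.
set a := lsubmx w; set B := vec_mx (lsubmx (rsubmx w)).
set c := rsubmx (rsubmx w).
have -> : w = row_mx a (row_mx (mxvec B) c) by rewrite vec_mxK !hsubmxK.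
have [X Xc] := sym_coord_surj c.
have PJ : P *m J (pi_ u) = 0.
  by rewrite mulmxBl mul1mx (normal_proj_jac lF) // subrr.
have LJ := jac_linv_jac lF Ou; set L := jac_linv F (pi_ u) in LJ.
pose G := g *m P *m g^T.
have Gu : G \in unitmx by rewrite unitmxE unitfE.
pose h1 := (B - g *m 'D_(a *m L) J (pi_ u)) *m L.
pose A := (X - h1 *m g^T) *m invmx G.
pose h := h1 + A *m (g *m P).
exists (frame_pair (a *m L) h).
rewrite -deriveE // derive_frame_eqn // frame_pi_pair frame_map_pair -/g.
congr row_mx; first by rewrite -(mul_jac lF) // -mulmxA LJ mulmx1.
congr (row_mx (mxvec _) _).
  rewrite /h mulmxDl -(mulmxA A) -(mulmxA g) PJ !mulmx0 addr0 /h1 -mulmxA LJ.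
  by rewrite mulmx1 subrK.
have hg : h *m g^T = X.
  rewrite /h mulmxDl -(mulmxA A) -/G /A -mulmxA mulVmx // mulmx1.
  by rewrite addrC subrK.
by rewrite -Xc hg -[g *m h^T]trmxK trmx_mul trmxK hg.
Qed.

Lemma frame_local_defining u0 : frame_bundle M u0 -> O (pi_ u0) ->
  local_defining (frame_bundle M) u0 frame_dom frame_eqn.
Proof.
move=> F0 O0; split.
- exact: open_frame_dom.
- exact: frame_bundle_dom.
- exact: smooth_frame_eqn.
- by move=> u Ou w; exact: frame_eqn_submersion.
apply/seteqP; split=> u /=.
- move=> [Fu [Ou G0]]; split=> //.
  have [Mu tu] := Fu.
  have [_ _ _ _ MO] := lF.
  have [_ Fu0] : [set x | O x /\ F x = 0] (pi_ u) by rewrite -MO.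
  rewrite /frame_eqn Fu0 frame_map_jac // linear0.
  have -> : g_ u *m (g_ u)^T = 1%:M.
    by apply/isometry_gram => a; have [] := tu a.
  by rewrite subrr linear0 mul0mx !row_mx0.
- move=> [Ou Fu]; split=> //; have [Opu _] := Ou.
  have F1 : F (pi_ u) = 0.
    by have := congr1 lsubmx Fu; rewrite /frame_eqn row_mxKl linear0.
  have Mu : M (pi_ u).
    have [_ _ _ _ MO] := lF.
    suff : (M `&` O) (pi_ u) by case.
    by rewrite MO.
  have := congr1 rsubmx Fu; rewrite /frame_eqn row_mxKr linear0 => F2.
  have F21 : g_ u *m J (pi_ u) = 0.
    apply: (can_inj mxvecK); rewrite linear0.
    by have := congr1 lsubmx F2; rewrite row_mxKl linear0.
  have gg : g_ u *m (g_ u)^T = 1%:M.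
    apply/eqP; rewrite -subr_eq0; apply/eqP; apply: sym_coord_eq0.
      by rewrite linearB /= trmx_mul trmxK trmx1.
    by have := congr1 rsubmx F2; rewrite row_mxKr linear0.
  split=> // a; split; last by move: a; apply/isometry_gram.
  by apply/(tangentE lF) => //; rewrite -mulmxA F21 mulmx0.
Qed.

(** Along the horizontal lift, the frame varies by [- g DQ].  Its tangency and
    isometry conditions are preserved to first order because of the identities
    [g DQ J = g DJ] and [g DQ g^T = 0], which come from differentiating
    [Q J = J] and [Q Q = Q] and from [g Q = 0]. *)
Lemma lift_tangent u w : frame_bundle M u -> O (pi_ u) ->
  w *m J (pi_ u) = 0 -> tangent (frame_bundle M) u (w *m lift_mx u).
Proof.
move=> Fu Ou wJ; have lG := frame_local_defining Fu Ou.
exists _, frame_dom, frame_eqn; split => //.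
have wQ : w *m Q (pi_ u) = 0 by apply/(normal_proj_eq0 lF).
have gQ := frame_map_normal_proj Fu Ou.
rewrite -deriveE; last first.
  exact: (smooth_differentiable smooth_frame_eqn (frame_bundle_dom Fu Ou)).
rewrite derive_frame_eqn // mul_lift_mx // frame_pi_pair frame_map_pair.
rewrite mulmxBr mulmx1 wQ subr0 -(mul_jac lF) // wJ.
set DQ := 'D_w Q (pi_ u).
have -> : - (g_ u *m DQ) *m J (pi_ u) + g_ u *m 'D_w J (pi_ u) = 0.
  have -> : g_ u *m 'D_w J (pi_ u) = g_ u *m (DQ *m J (pi_ u)).
    rewrite -[in LHS](derive_normal_proj_jac lF) // mulmxDr.
    by rewrite [X in _ + X]mulmxA gQ mul0mx addr0.
  by rewrite mulNmx mulmxA addNr.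
have gDg : g_ u *m DQ *m (g_ u)^T = 0.
  have QgT : Q (pi_ u) *m (g_ u)^T = 0.
    by rewrite -[Q (pi_ u)](trmx_normal_proj F) -trmx_mul gQ trmx0.
  rewrite -[in LHS](derive_normal_proj_idem lF w Ou : _ = DQ) -/DQ.
  rewrite -mulmxA mulmxDl.
  rewrite -(mulmxA DQ) QgT mulmx0 add0r -(mulmxA (Q _)) mulmxA gQ.
  by rewrite mul0mx.
have e1 : - (g_ u *m DQ) *m (g_ u)^T = 0 by rewrite mulNmx gDg oppr0.
have e2 : g_ u *m (- (g_ u *m DQ))^T = 0.
  by rewrite -[LHS]trmxK trmx_mul trmxK e1 trmx0.
by rewrite e1 e2 addr0 !linear0 mul0mx !row_mx0.
Qed.

Lemma Blift_mul a u : frame_bundle M u -> O (pi_ u) ->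
  Blift M a u = a *m g_ u *m lift_mx u.
Proof.
move=> Fu Ou; have [Mu tu] := Fu.
have agQ : a *m g_ u *m Q (pi_ u) = 0.
  by rewrite -mulmxA frame_map_normal_proj // mulmx0.
have agJ : a *m g_ u *m J (pi_ u) = 0.
  by rewrite -mulmxA frame_map_jac // mulmx0.
by rewrite mul_lift_mx // mulmxBr mulmx1 agQ subr0 /Blift (dQE lF).
Qed.

End FrameGeometry.

(** * Derivatives of the horizontal vector fields *)

Section LocalLift.
Context {R : realType} {n d : nat} (M : set 'rV[R]_n).
Variable (c : nat).
Hypothesis MP : submanifold c M.
Notation D := (n + d * n)%N.
Notation FB := (frame_bundle (d := d) M).
Implicit Type u : 'rV[R]_D.

(** All that the sequel needs from the geometry: near each frame a single
    smooth function [H] represents both families of horizontal fields, these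
    fields are tangent to the frame bundle, and [B_a] projects to [a g]. *)
Lemma local_lift u0 : FB u0 -> exists O (H : 'rV[R]_D -> 'M[R]_(n, D)),
  [/\ open O, O u0, smooth_on O H &
   forall u, FB u -> O u ->
    [/\ forall b, Vlift M b u = b *m H u,
        forall b, tangent FB u (Vlift M b u),
        forall a, Blift M a u = a *m frame_map u *m H u,
        forall a, tangent FB u (Blift M a u) &
        forall a, Blift M a u *m frame_pi_mx = a *m frame_map u]].
Proof.
move=> F0; have [M0 _] := F0; have [_ /(_ _ M0)] := MP.
move=> [ O [F lF]]; exists (@frame_pi R n d @^-1` O), (lift_mx F).
have [oO O0 _ _ _] := lF.
split => //.
- by apply: open_comp => // x _; exact: continuous_frame_pi.
- exact: smooth_lift_mx lF.
move=> u Fu Ou; have [Mu _] := Fu.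
split => [b|b|a|a|a].
- exact: (Vlift_mul lF).
- set P := 1%:M - normal_proj F (frame_pi u).
  have PP : P *m P = P.
    rewrite [LHS]mulmxBr mulmx1 {2}/P [X in _ - X]mulmxBl mul1mx.
    by rewrite (normal_proj_idem lF Ou) subrr subr0.
  have -> : Vlift M b u = b *m P *m lift_mx F u.
    rewrite (Vlift_mul lF b Mu Ou) (mul_lift_mx lF b Ou).
    by rewrite (mul_lift_mx lF (b *m P) Ou) -/P -[b *m P *m P]mulmxA PP.
  apply: (lift_tangent lF Fu Ou).
  by rewrite -mulmxA mulmxBl mul1mx (normal_proj_jac lF Ou) subrr mulmx0.
- exact: (Blift_mul lF).
- rewrite (Blift_mul lF) //; apply: (lift_tangent lF) => //.
  by rewrite -mulmxA (frame_map_jac lF) // mulmx0.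
- by rewrite mul_frame_pi_mx /Blift frame_pi_pair.
Qed.

(** Unlike the matrix [H] of [local_lift] it is defined globally, but it is
    regular only along the frame bundle. *)
Definition Vlift_mx u : 'M[R]_(n, D) := \matrix_i Vlift M (delta_mx 0 i) u.

Lemma mul_Vlift_mx b u : FB u -> b *m Vlift_mx u = Vlift M b u.
Proof.
move=> Fu; have [ O [H [_ Ou _ /(_ u Fu Ou) [VH _ _ _ _]]]] := local_lift Fu.
rewrite VH [in RHS](row_sum_delta b) mulmx_suml mulmx_sum_row.
by apply: eq_bigr => i _; rewrite rowK VH scalemxAl.
Qed.

(** The first argument is the direction of differentiation, as in the second
    order terms of a rough differential equation. *)
Definition Vlift_deriv (b b' : 'rV[R]_n) u :=
  mderive FB (Vlift M b') u (Vlift M b u).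

Definition Blift_deriv (a a' : 'rV[R]_d) u :=
  mderive FB (Blift M a') u (Blift M a u).

Lemma Vlift_derivE O (H : 'rV[R]_D -> 'M[R]_(n, D)) b b' u : open O -> O u ->
  smooth_on O H -> FB u ->
  (forall u, FB u -> O u -> forall b, Vlift M b u = b *m H u) ->
  tangent FB u (Vlift M b u) ->
  Vlift_deriv b b' u = b' *m 'D_(Vlift M b u) H u.
Proof.
move=> oO Ou sH Fu VH tV; rewrite /Vlift_deriv.
rewrite (@mderiveE _ _ _ FB O _ (fun u => b' *m H u)) //.
- rewrite (derive_lin (L := mulmx b')) //; first exact: mx_linear_continuous.
  exact: smooth_differentiable sH Ou.
- move=> l; apply: (Ck_lin (L := mulmx b')) => //.
  exact: mx_linear_continuous.
- by move=> x Fx Ox; rewrite VH.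
Qed.

Lemma derive_Blift_form O (H : 'rV[R]_D -> 'M[R]_(n, D)) a a' u p
    (beta : 'rV[R]_D -> 'M[R]_(D, p)) :
  open O -> O u -> smooth_on O H -> FB u ->
  (forall u, FB u -> O u -> forall a, Blift M a u = a *m frame_map u *m H u) ->
  tangent FB u (Blift M a u) -> differentiable beta u ->
  'D_(Blift M a u) (fun u => a' *m frame_map u *m H u *m beta u) u =
  Blift_deriv a a' u *m beta u + Blift M a' u *m 'D_(Blift M a u) beta u.
Proof.
move=> oO Ou sH Fu BH tB db.
have sB : smooth_on O (fun u => a' *m frame_map u *m H u).
  move=> l; apply: Ck_mulmx => //; apply: Ck_mulmx => //; first exact: Ck_cst.
  exact: Ck_frame_map.
rewrite derive_mulmx //; last exact: smooth_differentiable sB Ou.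
rewrite /Blift_deriv.
rewrite (@mderiveE _ _ _ FB O _ (fun u => a' *m frame_map u *m H u)) //.
  by rewrite (BH u Fu Ou a').
by move=> x Fx Ox; rewrite BH.
Qed.

(** The product [B_{a'} beta] depends only on the values of [beta] on the field
    [B_{a'}] along the frame bundle; so does its derivative along the tangent
    vector [B_a], which the product rule expands into the two terms below. *)
Lemma eq_Blift_form a a' u p (beta gam : 'rV[R]_D -> 'M[R]_(D, p)) O : FB u ->
  open O -> O u -> smooth_on O beta -> smooth_on O gam ->
  (forall u, FB u -> O u -> Blift M a' u *m beta u = Blift M a' u *m gam u) ->
  Blift_deriv a a' u *m beta u + Blift M a' u *m 'D_(Blift M a u) beta u =
  Blift_deriv a a' u *m gam u + Blift M a' u *m 'D_(Blift M a u) gam u.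
Proof.
move=> Fu oO Ou sb sg bg.
have [ O' [H [oO' O'u sH HP]]] := local_lift Fu.
have [_ _ BHu tB _] := HP u Fu O'u.
have BH x : FB x -> O' x -> forall a, Blift M a x = a *m frame_map x *m H x.
  by move=> Fx Ox; have [] := HP x Fx Ox.
have db := smooth_differentiable sb Ou; have dg := smooth_differentiable sg Ou.
do 2 rewrite -(derive_Blift_form _ oO' O'u sH Fu BH) //.
have dB : differentiable (fun u => a' *m frame_map u *m H u) u.
  apply: differentiable_mulmx; last exact: smooth_differentiable sH O'u.
  apply: differentiable_mulmx; first exact: differentiable_cst.
  exact: differentiable_frame_map.
apply/eqP; rewrite -subr_eq0; apply/eqP.
rewrite -deriveB; [|exact/diff_derivable/differentiable_mulmx..].
apply: (@derive_vanishing _ _ _ FB (O `&` O') _ _ _ Fu (tB a)).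
- exact: openI.
- by split.
- by apply: differentiableB; exact: differentiable_mulmx.
- move=> x Fx [Ox O'x]; have [_ _ Bx _ _] := HP x Fx O'x.
  by rewrite !fctE -!Bx (bg x Fx Ox) subrr.
Qed.

(** The geometric heart of the theorem.  Since [B_{a'}] is the horizontal lift
    [H] of its own projection [a' g], its derivative along [B_a] is the lift of
    the derivative of the projection, plus the derivative of the lift with its
    argument [a' g] frozen; as [B_a] is the lift of [a g], the latter is the
    derivative of [V_w] along [V_v] at [v (x) w = a g (x) a' g].  Formally this
    is [eq_Blift_form] for the forms [1] and [pi H]. *)
Lemma Blift_deriv_split a a' u : FB u ->
  Blift_deriv a a' u = Blift_deriv a a' u *m frame_pi_mx *m Vlift_mx u +
    tens_ext (fun b b' => Vlift_deriv b b' u)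
      (tens (a *m frame_map u) (a' *m frame_map u)).
Proof.
move=> Fu; have [ O [H [oO Ou sH HP]]] := local_lift Fu.
have [VHu tV BHu tB BPi] := HP u Fu Ou.
have VH x : FB x -> O x -> forall b, Vlift M b x = b *m H x.
  by move=> Fx Ox; have [] := HP x Fx Ox.
have dH := smooth_differentiable sH Ou.
have VmxH : Vlift_mx u = H u.
  by apply/row_matrixP => i; rewrite rowK VHu -rowE.
have s1 : smooth_on O (fun=> 1%:M : 'M[R]_D) by move=> l; exact: Ck_cst.
have sPH : smooth_on O (fun u => (frame_pi_mx : 'M[R]_(D, n)) *m H u).
  move=> l; apply: (Ck_mulmx (f := fun=> (frame_pi_mx : 'M[R]_(D, n)))) => //.
  exact: Ck_cst.
have HB x : FB x -> O x ->
    Blift M a' x *m 1%:M =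
    Blift M a' x *m ((frame_pi_mx : 'M[R]_(D, n)) *m H x).
  move=> Fx Ox; have [_ _ Bx _ BxPi] := HP x Fx Ox.
  by rewrite mulmx1 mulmxA BxPi Bx.
have := eq_Blift_form a Fu oO Ou s1 sPH HB.
have -> : 'D_(Blift M a u) (fun=> 1%:M : 'M[R]_D) u = 0 by exact: derive_cst.
rewrite mulmx0 addr0 mulmx1 => E; rewrite [LHS]E.
rewrite (derive_lin (L := mulmx frame_pi_mx)) //;
  last exact: mx_linear_continuous.
rewrite VmxH !mulmxA BPi; congr (_ + _).
rewrite BHu [a *m frame_map u in LHS]row_sum_delta mulmx_suml.
rewrite deriveE // linear_sum mulmx_sumr /tens_ext; apply: eq_bigr => i _.
under eq_bigr => j _.
  rewrite (Vlift_derivE _ oO Ou sH Fu VH) // /tens mxE big_ord1 mxE -scalerA.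
  over.
rewrite -scaler_sumr; under eq_bigr do rewrite scalemxAl.
rewrite -mulmx_suml -row_sum_delta -scalemxAl linearZ /= -scalemxAr.
by rewrite VHu deriveE.
Qed.

Lemma Vlift_mx_locally_continuous u0 : FB u0 ->
  exists O (h : 'rV[R]_D -> 'M[R]_(n, D)),
    [/\ open O, O u0, {for u0, continuous h} &
        forall u, FB u -> O u -> Vlift_mx u = h u].
Proof.
move=> F0; have [ O [H [oO Ou sH HP]]] := local_lift F0.
exists O, H; split => //; first exact: smooth_continuous sH Ou.
move=> u Fu Ou'; have [VHu _ _ _ _] := HP u Fu Ou'.
by apply/row_matrixP => i; rewrite rowK VHu -rowE.
Qed.

Lemma Vlift_deriv_locally_continuous b b' u0 : FB u0 ->
  exists O (h : 'rV[R]_D -> 'rV[R]_D),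
    [/\ open O, O u0, {for u0, continuous h} &
        forall u, FB u -> O u -> Vlift_deriv b b' u = h u].
Proof.
move=> F0; have [ O [H [oO Ou sH HP]]] := local_lift F0.
exists O, (fun u => \sum_i (b *m H u) 0 i *: (b' *m 'D_(delta_mx 0 i) H u)).
have C l : Ck_on l O
    (fun u => \sum_i (b *m H u) 0 i *: (b' *m 'D_(delta_mx 0 i) H u)).
  apply: Ck_sum => // i _; apply: Ck_scale => //.
    apply: (Ck_entry (f := fun u => b *m H u)) => //.
    by apply: Ck_mulmx => //; exact: Ck_cst.
  by apply: Ck_mulmx => //; [exact: Ck_cst|exact: smooth_derive].
split => //; first exact: (C 0).
move=> u Fu Ou'; have [VHu tV _ _ _] := HP u Fu Ou'.
rewrite (Vlift_derivE _ oO Ou' sH Fu) //; last first.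
  by move=> x Fx Ox; have [] := HP x Fx Ox.
rewrite VHu derive_coords; last exact: smooth_differentiable sH Ou'.
by rewrite mulmx_sumr; apply: eq_bigr => i _; rewrite -scalemxAr.
Qed.

End LocalLift.

(** * Tensors and approximate equality *)

Section TensExt.
Context {R : realType} {n : nat}.

Lemma tens_delta (i j : 'I_n) :
  tens (delta_mx 0 i) (delta_mx 0 j) = delta_mx i j :> 'M[R]_n.
Proof. by rewrite /tens trmx_delta mul_delta_mx. Qed.

Lemma tens_ext_id (A : 'M[R]_n) : tens_ext tens A = A.
Proof.
rewrite [RHS]matrix_sum_delta /tens_ext; apply: eq_bigr => i _.
by apply: eq_bigr => j _; rewrite tens_delta.
Qed.

(** Only the two instances of linearity that the expansion uses are asked of
    [B], because for derivatives linearity in the direction is a pointwise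
    property. *)
Lemma tens_ext_tens {V : lmodType R} (B : 'rV[R]_n -> 'rV[R]_n -> V) v w :
  (forall y, B v y = \sum_i v 0 i *: B (delta_mx 0 i) y) ->
  (forall i, B (delta_mx 0 i) w =
     \sum_j w 0 j *: B (delta_mx 0 i) (delta_mx 0 j)) ->
  tens_ext B (tens v w) = B v w.
Proof.
move=> Bl Br; rewrite Bl /tens_ext; apply: eq_bigr => i _.
rewrite Br scaler_sumr; apply: eq_bigr => j _.
by rewrite /tens mxE big_ord1 mxE scalerA.
Qed.

Lemma tens_ext_linear {V : lmodType R} (B : 'rV[R]_n -> 'rV[R]_n -> V) :
  linear (tens_ext B).
Proof.
move=> c A A'; rewrite /tens_ext scaler_sumr -big_split; apply: eq_bigr => i _.
rewrite /= scaler_sumr -big_split; apply: eq_bigr => j _.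
by rewrite /= !mxE scalerDl scalerA.
Qed.
HB.instance Definition _ (V : lmodType R) (B : 'rV[R]_n -> 'rV[R]_n -> V) :=
  GRing.isLinear.Build R _ _ _ (tens_ext B) (tens_ext_linear B).

Lemma tens_ext_comp {m} {V : lmodType R} (B : 'rV[R]_n -> 'rV[R]_n -> V)
    (C : 'rV[R]_m -> 'rV[R]_m -> 'M[R]_n) A :
  tens_ext B (tens_ext C A) = tens_ext (fun a b => tens_ext B (C a b)) A.
Proof.
rewrite [X in tens_ext B X]/tens_ext linear_sum; apply: eq_bigr => i _.
by rewrite linear_sum; apply: eq_bigr => j _; rewrite linearZ.
Qed.

Lemma tens_extD {V : lmodType R} (B C : 'rV[R]_n -> 'rV[R]_n -> V) A :
  tens_ext B A + tens_ext C A = tens_ext (fun a b => B a b + C a b) A.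
Proof.
rewrite /tens_ext -big_split; apply: eq_bigr => i _ /=.
by rewrite -big_split; apply: eq_bigr => j _ /=; rewrite scalerDr.
Qed.

Lemma tens_ext_mulmx {p q r} (B : 'rV[R]_n -> 'rV[R]_n -> 'M[R]_(p, q))
    (X : 'M[R]_(q, r)) A :
  tens_ext B A *m X = tens_ext (fun a b => B a b *m X) A.
Proof.
rewrite /tens_ext mulmx_suml; apply: eq_bigr => i _.
by rewrite mulmx_suml; apply: eq_bigr => j _; rewrite scalemxAl.
Qed.

Lemma eq_tens_ext {V : lmodType R} (B C : 'rV[R]_n -> 'rV[R]_n -> V) A :
  (forall a b, B a b = C a b) -> tens_ext B A = tens_ext C A.
Proof.
by move=> BC; apply: eq_bigr => i _; apply: eq_bigr => j _; rewrite BC.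
Qed.

Lemma tens_ext_lipschitz {V : normedModType R}
    (B : 'rV[R]_n -> 'rV[R]_n -> V) K (A A' : 'M[R]_n) :
  (forall i j, `|B (delta_mx 0 i) (delta_mx 0 j)| <= K) ->
  `|tens_ext B A - tens_ext B A'| <= (n * n)%:R * K * `|A - A'|.
Proof.
move=> BK; rewrite /tens_ext -sumrB.
have -> : (n * n)%:R * K * `|A - A'| =
    \sum_(i < n) \sum_(j < n) (K * `|A - A'|).
  by rewrite !sumr_const !card_ord -mulrnA -mulrA mulr_natl.
apply: le_trans (ler_norm_sum _ _ _) _; apply: ler_sum => i _.
rewrite -sumrB; apply: le_trans (ler_norm_sum _ _ _) _; apply: ler_sum => j _.
rewrite -scalerBl normrZ mulrC; apply: ler_pM => //.
by have := le_mx_entry (A - A') i j; rewrite !mxE.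
Qed.

End TensExt.

Lemma norm_mulmx {R : realType} {m n p} (A : 'M[R]_(m, n)) (B : 'M[R]_(n, p)) :
  `|A *m B| <= n%:R * `|A| * `|B|.
Proof.
apply: mx_norm_le => [|i j]; first by rewrite !mulr_ge0.
rewrite mxE; apply: le_trans (ler_norm_sum _ _ _) _.
have -> : n%:R * `|A| * `|B| = \sum_(l < n) `|A| * `|B|.
  by rewrite sumr_const card_ord -mulrA mulr_natl.
by apply: ler_sum => l _; rewrite normrM ler_pM // le_mx_entry.
Qed.

Lemma norm_tens_mulmx {R : realType} {m q} (A : 'M[R]_(m, q)) K (i j : 'I_m) :
  `|A| <= K ->
  `|tens (delta_mx 0 i *m A) (delta_mx 0 j *m A)| <= K * K.
Proof.
move=> AK; have K0 : 0 <= K by apply: le_trans AK.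
apply: mx_norm_le; first exact: mulr_ge0.
move=> a b; rewrite /tens mxE big_ord1 mxE -!rowE !mxE normrM.
by apply: ler_pM => //; exact: le_trans (le_mx_entry _ _ _) AK.
Qed.

Lemma tens_ext_tens_mulmx {R : realType} {m q} (A : 'M[R]_(m, q)) v w :
  tens_ext (fun v w => tens (v *m A) (w *m A)) (tens v w) =
  tens (v *m A) (w *m A).
Proof.
apply: tens_ext_tens => [b|i].
  rewrite [v in LHS]row_sum_delta mulmx_suml /tens linear_sum mulmx_suml.
  by apply: eq_bigr => i _; rewrite -scalemxAl linearZ /= -scalemxAl.
rewrite [w in LHS]row_sum_delta mulmx_suml /tens mulmx_sumr.
by apply: eq_bigr => j _; rewrite -scalemxAl -scalemxAr.
Qed.

Section Approx.
Context {R : realType}.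
Variables (T p : R) (omega : R -> R -> R).
Notation approx := (Defs.approx T p omega).

Lemma approx_ext {V : normedModType R} (g h : R -> R -> V) :
  (forall s t, 0 <= s -> s <= t <= T -> g s t = h s t) -> approx g h.
Proof.
move=> gh; exists 1, 0; split => // s t s0 stT _.
by rewrite gh // subrr normr0 mul0r.
Qed.

Lemma approx_sym {V : normedModType R} (g h : R -> R -> V) :
  approx g h -> approx h g.
Proof.
move=> [d [C [d0 gh]]]; exists d, C; split => // s t s0 stT std.
by rewrite distrC gh.
Qed.

Lemma approx_trans {V : normedModType R} (f g h : R -> R -> V) :
  approx f g -> approx g h -> approx f h.
Proof.
move=> [d [C [d0 fg]]] [d' [C' [d'0 gh]]].
exists (Num.min d d'), (C + C'); split; first by rewrite lt_min d0.
move=> s t s0 stT; rewrite le_min => /andP[std std'].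
apply: le_trans (ler_distD (g s t) _ _) _.
by rewrite mulrDl lerD // ?fg ?gh.
Qed.

Lemma approxD {V : normedModType R} (f g f' g' : R -> R -> V) :
  approx f g -> approx f' g' ->
  approx (fun s t => f s t + f' s t) (fun s t => g s t + g' s t).
Proof.
move=> [d [C [d0 fg]]] [d' [C' [d'0 gh]]].
exists (Num.min d d'), (C + C'); split; first by rewrite lt_min d0.
move=> s t s0 stT; rewrite le_min => /andP[std std'].
rewrite opprD addrACA; apply: le_trans (ler_normD _ _) _.
by rewrite mulrDl lerD // ?fg ?gh.
Qed.

(** The maps may vary with time as long as their Lipschitz constant does not;
    for the coefficients of the equations, this uniformity comes from
    [trace_bounded]. *)
Lemma approx_lipschitz {V W : normedModType R} (L : R -> V -> W) K
    (g h : R -> R -> V) :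
  0 <= K ->
  (forall s, 0 <= s <= T -> forall v w, `|L s v - L s w| <= K * `|v - w|) ->
  approx g h -> approx (fun s t => L s (g s t)) (fun s t => L s (h s t)).
Proof.
move=> K0 LK [d [C [d0 gh]]]; exists d, (K * C); split => // s t s0 stT std.
have sT : 0 <= s <= T by rewrite s0 /=; case/andP: stT; exact: le_trans.
by apply: le_trans (LK s sT _ _) _; rewrite -mulrA ler_wpM2l // gh.
Qed.

Lemma approx_mulmx {m n q} (A : R -> 'M[R]_(n, q)) K
    (g h : R -> R -> 'M[R]_(m, n)) :
  (forall s, 0 <= s <= T -> `|A s| <= K) -> 0 <= K ->
  approx g h -> approx (fun s t => g s t *m A s) (fun s t => h s t *m A s).
Proof.
move=> AK K0.
apply: (approx_lipschitz (L := fun s v => v *m A s) (K := n%:R * K)).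
  by rewrite mulr_ge0.
move=> s sT v w; rewrite -mulmxBl; apply: le_trans (norm_mulmx _ _) _.
by rewrite mulrAC; apply: ler_wpM2r => //; apply: ler_wpM2l => //; exact: AK.
Qed.

Lemma approx_tens_ext {n} {V : normedModType R}
    (B : R -> 'rV[R]_n -> 'rV[R]_n -> V) K (g h : R -> R -> 'M[R]_n) :
  (forall s, 0 <= s <= T -> forall i j,
     `|B s (delta_mx 0 i) (delta_mx 0 j)| <= K) -> 0 <= K ->
  approx g h ->
  approx (fun s t => tens_ext (B s) (g s t))
         (fun s t => tens_ext (B s) (h s t)).
Proof.
move=> BK K0.
apply: (approx_lipschitz (L := fun s => tens_ext (B s)) (K := (n * n)%:R * K)).
  by rewrite mulr_ge0.
by move=> s sT v w; apply: tens_ext_lipschitz => i j; exact: BK.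
Qed.

End Approx.

(** The function [f] is regular only along [S], in the sense that it agrees
    there with continuous functions near each point; compactness of the
    interval patches the local bounds. *)
Lemma trace_bounded {R : realType} {V W : normedModType R} (T : R)
    (u : R -> V) (S : set V) (f : V -> W) :
  {within `[0, T], continuous u} -> (forall t, 0 <= t <= T -> S (u t)) ->
  (forall x, S x -> exists O (h : V -> W),
    [/\ open O, O x, {for x, continuous h} &
        forall y, S y -> O y -> f y = h y]) ->
  exists2 C, 0 <= C & forall t, 0 <= t <= T -> `|f (u t)| <= C.
Proof.
move=> cu Su Sf.
suff : \forall C \near +oo, `[0, T]%classic `<=` [set t | `|f (u t)| <= C].
  move=> /pinfty_ex_gt0 [C C0 HC]; exists C; first exact: ltW.
  by move=> t tT; apply: HC; rewrite /= in_itv.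
have := (near_covering_withinP `[0, T]%classic).2
  ((compact_near_coveringP _).1 (@segment_compact R 0 T)).
apply.
move=> t tT /=.
have tT' : 0 <= t <= T by move: tT; rewrite /= in_itv.
have [ O [h [oO Ot ch fh]]] := Sf _ (Su t tT').
have ut : u @ within `[0, T]%classic (nbhs t) --> u t.
  by move/subspace_continuousP : cu; apply.
have nO : \forall x \near u t, O x /\ `|h x - h (u t)| < 1.
  apply: filterI; first exact: open_nbhs_nbhs.
  move/cvgrPdist_lt : ch => /(_ _ ltr01).
  by apply: filterS => x; rewrite distrC.
have N1 : \forall t' \near t, `[0, T]%classic t' ->
    O (u t') /\ `|h (u t') - h (u t)| < 1 := ut _ nO.
exists ([set t' | `[0, T]%classic t' ->
    O (u t') /\ `|h (u t') - h (u t)| < 1], [set C | 1 + `|h (u t)| <= C]).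
  by split => //=; exact: nbhs_pinfty_ge.
move=> [t' C] /= [+ C1] t'T => /(_ t'T) [Out' hut'].
have t'T' : 0 <= t' <= T by move: t'T; rewrite /= in_itv.
rewrite fh //; last exact: Su.
rewrite -(subrK (h (u t)) (h (u t'))).
apply: le_trans (ler_normD _ _) (le_trans _ C1).
by rewrite lerD2r ltW.
Qed.

(** * The image of a rough path under a linear map *)

Section LinearImage.
Context {R : realType}.
Variables (T p : R) (omega : R -> R -> R).
Context {n k : nat}.
Variables (A : 'M[R]_(n, k)).

Definition linear_image (X : rpath (R := R) n) : rpath (R := R) k :=
  (fun t => incr X.1 0 t *m A, fun s t => A^T *m X.2 s t *m A).

Lemma incr_linear_image X s t :
  incr (linear_image X).1 s t = incr X.1 s t *m A.
Proof. by rewrite /incr /= /incr -mulmxBl opprB addrA subrK. Qed.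

Lemma WG_linear_image X : WG T p omega X -> WG T p omega (linear_image X).
Proof.
case: X => x XX; rewrite /linear_image /= => -[cx cX chen [C bd] sym].
have incrE s t : incr (fun t => incr x 0 t *m A) s t = incr x s t *m A.
  exact: (incr_linear_image (x, XX)).
split.
- have -> : (fun t => incr x 0 t *m A) = (fun y => (y - x 0) *m A) \o x by [].
  move=> t; apply: (@continuous_comp (subspace `[0, T]) _ _ x); first exact: cx.
  apply: (@continuous_comp _ _ _ (fun y => y - x 0) (mulmxr A)).
    by apply: continuousB; [exact: cvg_id|exact: cst_continuous].
  exact: mx_linear_continuous.
- have -> : (fun st : R * R => A^T *m XX st.1 st.2 *m A) =
      (mulmxr A \o mulmx A^T) \o (fun st => XX st.1 st.2) by [].
  move=> t; apply: (@continuous_comp (subspace (simplex T)) _ _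
    (fun st => XX st.1 st.2)); first exact: cX.
  exact: (@mx_linear_continuous _ _ _ _
    (mulmxr A \o mulmx A^T : {linear _ -> _})).
- move=> s u t s0 sut tT; rewrite (chen s u t) // !mulmxDr !mulmxDl !incrE.
  by rewrite /tens trmx_mul !mulmxA.
- have [K1 K10 HK1] := linear_lipschitz (f := mulmxr A)
    (@mx_linear_continuous _ _ _ _ (mulmxr A : {linear 'rV[R]_n -> _})).
  have [K2 K20 HK2] := linear_lipschitz
    (f := mulmxr A \o mulmx A^T : {linear _ -> _})
    (@mx_linear_continuous _ _ _ _ (mulmxr A \o mulmx A^T : {linear _ -> _})).
  pose K := Num.max K1 K2.
  have K0 : 0 <= K by rewrite le_max ltW.
  exists (K * C) => s t s0 stT; have [b1 b2] := bd s t s0 stT.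
  have scale (a b c : R) : 0 <= c -> a <= K * b -> b / c <= C -> a / c <= K * C.
    move=> c0 ab bc; apply: (@le_trans _ _ (K * b / c)).
      by rewrite ler_wpM2r // invr_ge0.
    by rewrite -mulrA ler_wpM2l.
  split; [apply: scale b1|apply: scale b2]; rewrite ?powR_ge0 //.
    rewrite incrE; apply: le_trans (HK1 _) _.
    by rewrite ler_wpM2r // le_max lexx.
  apply: le_trans (HK2 _) _.
  by rewrite ler_wpM2r // le_max lexx orbT.
- move=> s t s0 stT; rewrite incrE.
  have -> : (A^T *m XX s t *m A)^T = A^T *m (XX s t)^T *m A.
    by rewrite !trmx_mul trmxK mulmxA.
  rewrite -mulmxDl -mulmxDr scalemxAl scalemxAr sym //.
  by rewrite -scalemxAr -scalemxAl /tens trmx_mul !mulmxA.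
Qed.

(** The form is constant, so its derivative contributes nothing and the defining
    approximations are equalities. *)
Lemma linear_image_integral X : WG T p omega X ->
  is_rough_integral T p omega (fun=> A) X (linear_image X).
Proof.
move=> WX; have WY := WG_linear_image WX; case: X WX WY => x XX WX WY.
split => //=.
- by rewrite /incr subrr mul0mx.
- apply: approx_ext => s t s0 stT.
  rewrite (incr_linear_image (x, XX)) /tens_ext big1 ?addr0 // => i _.
  rewrite big1 // => j _.
  have -> : 'D_(delta_mx 0 i) (fun=> A) (x s) = 0 by exact: derive_cst.
  by rewrite mulmx0 scaler0.
- apply: approx_ext => s t s0 stT.
  rewrite -{1}(tens_ext_id (XX s t)) [in LHS]/tens_ext.
  rewrite mulmx_sumr mulmx_suml; apply: eq_bigr => i _.
  rewrite mulmx_sumr mulmx_suml; apply: eq_bigr => j _.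
  by rewrite -scalemxAr -scalemxAl /tens trmx_mul !mulmxA.
Qed.

End LinearImage.

(** * Parallel translation *)

Section Pushforward.
Context {R : realType} {n d : nat} (M : set 'rV[R]_n).
Notation D := (n + d * n)%N.
Notation FB := (frame_bundle (d := d) M).
Notation pi_mx := (frame_pi_mx : 'M[R]_(D, n)).
Variables (T p : R) (omega : R -> R -> R).

Lemma mderive_frame_pi (u v : 'rV[R]_D) :
  FB u -> tangent FB u v -> mderive FB (@frame_pi R n d) u v = v *m pi_mx.
Proof.
move=> Fu tv; rewrite (@mderiveE _ _ _ FB setT _ (@frame_pi R n d)) //.
- rewrite deriveE; last exact/linear_differentiable/continuous_frame_pi.
  by rewrite diff_lin ?mul_frame_pi_mx //; exact: continuous_frame_pi.
- exact: openT.
- move=> l; apply: (Ck_lin (L := @frame_pi R n d) (f := id)).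
  + exact: continuous_frame_pi.
  + exact: openT.
  + exact: Ck_id.
Qed.

(** The pushforward is an integral selected among those of the extensions
    [beta] of the differential of the projection.  The constant extension has
    an integral by [linear_image_integral], so the selection is meaningful; but
    nothing more is known about the [beta] that it comes from. *)
Lemma rough_integral_frame_pi (U : rpath (R := R) D) : WG T p omega U ->
  exists O (beta : 'rV[R]_D -> 'M[R]_(D, n)),
  [/\ open O, FB `<=` O, smooth_on O beta,
      forall u v, FB u -> tangent FB u v -> v *m beta u = v *m pi_mx
    & is_rough_integral T p omega beta U
        (rough_integral_on T p omega FB (mderive FB (@frame_pi R n d)) U)].
Proof.
move=> WU; rewrite /rough_integral_on.
case: xgetP => [Y _|/(_ (linear_image pi_mx U)) []].
- move=> [ O [beta [oO sO sb bE bY]]]; exists O, beta; split => // u v Fu tv.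
  by rewrite bE // mderive_frame_pi.
exists setT, (fun=> pi_mx); split => //.
- exact: openT.
- by move=> l; exact: Ck_cst.
- by move=> u v Fu tv; rewrite mderive_frame_pi.
- exact: linear_image_integral.
Qed.

End Pushforward.

Section ParallelTranslation.
Context {R : realType}.
Variables (T p : R) (omega : R -> R -> R).
Context {n d c : nat} (M : set 'rV[R]_n).
Hypothesis MP : submanifold c M.
Notation D := (n + d * n)%N.
Notation FB := (frame_bundle (d := d) M).
Notation pi_mx := (frame_pi_mx : 'M[R]_(D, n)).
Notation approx := (Defs.approx T p omega).
Variables (z : R -> 'rV[R]_d) (ZZ : R -> R -> 'M[R]_d).
Variables (u : R -> 'rV[R]_D) (UU : R -> R -> 'M[R]_D).
Hypothesis cu : {within `[0, T], continuous u}.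
Hypothesis Fu : forall t, 0 <= t <= T -> FB (u t).
Hypothesis uE : approx (incr u) (fun s t => Blift M (incr z s t) (u s) +
  tens_ext (fun a b => Blift_deriv M a b (u s)) (ZZ s t)).
Hypothesis UUE : approx UU (fun s t =>
  tens_ext (fun a b => tens (Blift M a (u s)) (Blift M b (u s))) (ZZ s t)).
Variables (O : set 'rV[R]_D) (beta : 'rV[R]_D -> 'M[R]_(D, n)).
Hypotheses (oO : open O) (sO : FB `<=` O) (sb : smooth_on O beta).
Hypothesis bE : forall u v, FB u -> tangent FB u v -> v *m beta u = v *m pi_mx.
Variables (y : R -> 'rV[R]_n) (YY : R -> R -> 'M[R]_n).
Hypothesis yE : approx (incr y) (fun s t => incr u s t *m beta (u s) +
  tens_ext (fun v w => w *m 'D_v beta (u s)) (UU s t)).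
Hypothesis YYE : approx YY (fun s t =>
  tens_ext (fun v w => tens (v *m beta (u s)) (w *m beta (u s))) (UU s t)).

Let g s : 'M[R]_(d, n) := frame_map (u s).

Lemma Blift_trace s : 0 <= s <= T ->
  [/\ forall a, Blift M a (u s) = a *m g s *m Vlift_mx M (u s),
      forall a, tangent FB (u s) (Blift M a (u s)),
      forall a, Blift M a (u s) *m pi_mx = a *m g s
    & forall a, Blift M a (u s) *m beta (u s) = a *m g s].
Proof.
move=> sT; have Fs := Fu sT; have [ A [H [oA As sH HP]]] := local_lift MP Fs.
have [VHu tV BHu tB BPi] := HP _ Fs As.
split; [|exact: tB|exact: BPi|].
  by move=> a; rewrite (mul_Vlift_mx MP _ Fs) VHu; exact: BHu.
by move=> a; rewrite (bE Fs (tB a)); exact: BPi.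
Qed.

Lemma beta_bounded :
  exists2 K, 0 <= K & forall s, 0 <= s <= T -> `|beta (u s)| <= K.
Proof.
apply: (trace_bounded cu Fu) => x Fx; exists O, beta.
split; [exact: oO|exact: sO| |by []].
by apply: smooth_continuous sb _; exact: sO.
Qed.

Lemma finite_bound {V : normedModType R} m (f : 'I_m -> 'I_m -> R -> V) :
  (forall i j, exists2 K, 0 <= K & forall s, 0 <= s <= T -> `|f i j s| <= K) ->
  exists2 K, 0 <= K & forall s, 0 <= s <= T -> forall i j, `|f i j s| <= K.
Proof.
move=> fb; have [K HK] := choice (fun ij : 'I_m * 'I_m =>
  (let: ex_intro2 k k0 hk := fb ij.1 ij.2 in
   ex_intro (fun k => 0 <= k /\ forall s, 0 <= s <= T -> `|f ij.1 ij.2 s| <= k)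
     k (conj k0 hk))).
exists (\sum_ij K ij); first by apply: sumr_ge0 => ij _; have [] := HK ij.
move=> s sT i j; have [_ /(_ s sT) /= le1] := HK (i, j).
apply: le_trans le1 _; rewrite (bigD1 (i, j)) //= lerDl.
by apply: sumr_ge0 => ij _; have [] := HK ij.
Qed.

Lemma dbeta_bounded : exists2 K, 0 <= K & forall s, 0 <= s <= T ->
  forall i j : 'I_D,
    `|delta_mx 0 j *m 'D_(delta_mx 0 i) beta (u s) : 'rV_n| <= K.
Proof.
apply: finite_bound => i j.
apply: (trace_bounded (f := fun x => (delta_mx 0 j : 'rV_D) *m
   'D_(delta_mx 0 i) beta x) cu Fu) => x Fx.
exists O, (fun x => (delta_mx 0 j : 'rV_D) *m 'D_(delta_mx 0 i) beta x).
have C l : Ck_on l O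
    (fun x => (delta_mx 0 j : 'rV_D) *m 'D_(delta_mx 0 i) beta x).
  apply: (Ck_mulmx (f := fun=> (delta_mx 0 j : 'rV_D))); first exact: oO.
    exact: Ck_cst.
  exact: smooth_derive.
split; [exact: oO|exact: sO| |by []].
by apply: (C 0); exact: sO.
Qed.

Lemma Vlift_mx_bounded :
  exists2 K, 0 <= K & forall s, 0 <= s <= T -> `|Vlift_mx M (u s)| <= K.
Proof.
apply: (trace_bounded cu Fu) => x Fx; exact: (Vlift_mx_locally_continuous MP).
Qed.

Lemma Vlift_deriv_bounded :
  exists2 K, 0 <= K & forall s, 0 <= s <= T -> forall i j,
  `|Vlift_deriv M (delta_mx 0 i) (delta_mx 0 j) (u s)| <= K.
Proof.
apply: finite_bound => i j; apply: (trace_bounded cu Fu) => x Fx.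
exact: (Vlift_deriv_locally_continuous MP).
Qed.

(** In terms of [Z], the projected path moves by [g] applied to [z] and by the
    projections of the derivatives of [B].  The contribution of [beta] off the
    tangent spaces disappears by [eq_Blift_form]. *)
Lemma pi_first_level : approx (incr y) (fun s t =>
  incr z s t *m g s +
  tens_ext (fun a b => Blift_deriv M a b (u s) *m pi_mx) (ZZ s t)).
Proof.
have [K K0 bK] := beta_bounded; have [K' K'0 dK] := dbeta_bounded.
apply: approx_trans yE _.
apply: approx_trans.
  apply: approxD; first exact: (approx_mulmx bK K0 uE).
  exact: (approx_tens_ext
    (B := fun s v w => w *m 'D_v beta (u s)) dK K'0 UUE).
apply: approx_ext => s t s0 /andP[st tT].
have sT : 0 <= s <= T by rewrite s0 (le_trans st).
have [_ tB BPi Bb] := Blift_trace sT; have Fs := Fu sT; have Os := sO Fs.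
have dbs := smooth_differentiable sb Os.
rewrite mulmxDl Bb -addrA tens_ext_mulmx tens_ext_comp tens_extD.
congr (_ + _); apply: eq_tens_ext => a b.
rewrite tens_ext_tens.
- have sPi : smooth_on O (fun=> pi_mx) by move=> l; exact: Ck_cst.
  rewrite (eq_Blift_form MP a Fs oO Os sb sPi); last first.
    move=> x Fx Ox; apply: bE => //.
    by have [A [H [_ Ax _ /(_ x Fx Ax) []]]] := local_lift MP Fx.
  have -> : 'D_(Blift M a (u s)) (fun=> pi_mx) (u s) = 0 by exact: derive_cst.
  by rewrite mulmx0 addr0.
- move=> w; rewrite derive_coords // mulmx_sumr.
  by apply: eq_bigr => i _; rewrite -scalemxAr.
- move=> i; rewrite [Blift _ _ _ in LHS]row_sum_delta mulmx_suml.
  by apply: eq_bigr => j _; rewrite -scalemxAl.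
Qed.

Lemma pi_second_level : approx YY (fun s t =>
  tens_ext (fun a b => tens (a *m g s) (b *m g s)) (ZZ s t)).
Proof.
have [K K0 bK] := beta_bounded.
apply: approx_trans YYE _; apply: approx_trans.
  apply: (approx_tens_ext (K := K * K)
    (B := fun s v w => tens (v *m beta (u s)) (w *m beta (u s))) _ _ UUE).
    by move=> s sT i j; apply: norm_tens_mulmx; exact: bK.
  exact: mulr_ge0.
apply: approx_ext => s t s0 /andP[st tT].
have sT : 0 <= s <= T by rewrite s0 (le_trans st).
have [_ _ _ Bb] := Blift_trace sT.
rewrite tens_ext_comp; apply: eq_tens_ext => a b.
by rewrite tens_ext_tens_mulmx; congr tens; exact: Bb.
Qed.

(** Lifting the expansion [pi_first_level] horizontally and adding the
    derivatives of [V] weighted by [pi_second_level] gives back the expansion of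
    [u], term by term: the terms in [z] because [B_a] is the lift of [a g], the
    terms in [ZZ] by [Blift_deriv_split]. *)
Lemma Vlift_first_level : approx (incr u) (fun s t =>
  Vlift M (incr y s t) (u s) +
  tens_ext (fun b b' => Vlift_deriv M b b' (u s)) (YY s t)).
Proof.
have [K K0 VK] := Vlift_mx_bounded; have [K' K'0 VVK] := Vlift_deriv_bounded.
have H := approxD (approx_mulmx VK K0 pi_first_level)
  (approx_tens_ext (B := fun s b b' => Vlift_deriv M b b' (u s)) VVK K'0
    pi_second_level).
apply: approx_trans uE _; apply: approx_sym.
apply: approx_trans; first (apply: approx_trans H; apply: approx_ext).
  move=> s t s0 /andP[st tT].
  have sT : 0 <= s <= T by rewrite s0 (le_trans st).
  by rewrite (mul_Vlift_mx MP) //; exact: Fu.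
apply: approx_ext => s t s0 /andP[st tT].
have sT : 0 <= s <= T by rewrite s0 (le_trans st).
have [BV _ _ _] := Blift_trace sT.
rewrite mulmxDl -BV -addrA tens_ext_mulmx tens_ext_comp tens_extD.
congr (_ + _); apply: eq_tens_ext => a b.
by rewrite [RHS](Blift_deriv_split MP) //; exact: Fu.
Qed.

Lemma Vlift_second_level : approx UU (fun s t =>
  tens_ext (fun b b' => tens (Vlift M b (u s)) (Vlift M b' (u s))) (YY s t)).
Proof.
have [K K0 VK] := Vlift_mx_bounded.
apply: approx_trans UUE _; apply: approx_sym.
have bd s : 0 <= s <= T -> forall i j, `|tens (delta_mx 0 i *m Vlift_mx M (u s))
    (delta_mx 0 j *m Vlift_mx M (u s))| <= K * K.
  by move=> sT i j; apply: norm_tens_mulmx; exact: VK.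
have H := approx_tens_ext
  (B := fun s v w => tens (v *m Vlift_mx M (u s)) (w *m Vlift_mx M (u s)))
  bd (mulr_ge0 K0 K0) pi_second_level.
apply: approx_trans; first (apply: approx_trans H; apply: approx_ext).
  move=> s t s0 /andP[st tT].
  have sT : 0 <= s <= T by rewrite s0 (le_trans st).
  have Fs := Fu sT; apply: eq_tens_ext => a b.
  by congr tens; rewrite (mul_Vlift_mx MP _ Fs).
apply: approx_ext => s t s0 /andP[st tT].
have sT : 0 <= s <= T by rewrite s0 (le_trans st).
have [BV _ _ _] := Blift_trace sT.
rewrite tens_ext_comp; apply: eq_tens_ext => a b.
by rewrite tens_ext_tens_mulmx; congr tens; rewrite BV.
Qed.

End ParallelTranslation.

Theorem theorem5p17 (R : realType) (T p : R) (omega : R -> R -> R)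
  (T_gt0 : 0 < T) (p_ge2 : 2 <= p) (p_lt3 : p < 3)
  (omegaP : control T omega)
  (N d : nat) (M : set 'rV[R]_N) (MP : submanifold d M)
  (Z : rpath (R := R) d) (U : rpath (R := R) (N + d * N))
  (uo : 'rV[R]_(N + d * N)) (uoP : frame_bundle M uo)
  (ZP : WG T p omega Z) (Z0 : Z.1 0 = 0)
  (UP : WG_on T p omega (frame_bundle M) U)
  (Usol : RDE_solution T p omega (frame_bundle M) (Blift M) Z U)
  (U0 : U.1 0 = uo) :
  RDE_solution T p omega (frame_bundle M) (Vlift M)
    (rough_pushforward T p omega (frame_bundle M) frame_pi U) U /\
  U.1 0 = uo.
Proof.
split=> //; have [WU FU _] := UP.
have [ O [beta [oO sO sb bE]]] := rough_integral_frame_pi M WU.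
rewrite /rough_pushforward; case: (rough_integral_on _ _ _ _ _ _) => y YY.
case: Z U {ZP Z0} UP Usol U0 WU FU => z ZZ [u UU] UP [_ _ uE UUE] _ WU FU.
have [cu _ _ _ _] := WU.
move=> [WY y0 yE YYE].
have incrE : incr (fun t => frame_pi (u 0) + y t) = incr y.
  apply/funext => s; apply/funext => t.
  by rewrite /incr opprD addrACA subrr add0r.
rewrite /RDE_solution incrE; split; [|exact: UP| |].
- case: WY => cy cY chen bd sym; split; rewrite ?incrE //.
  move=> t; apply: (@continuous_comp (subspace `[0, T]) _ _ y
    (fun v => frame_pi (u 0) + v)); first exact: cy.
  by apply: continuousD; [exact: cst_continuous|exact: cvg_id].
- exact: (Vlift_first_level MP cu FU uE UUE oO sO sb bE yE YYE).
- exact: (Vlift_second_level MP cu FU UUE oO sO sb bE YYE).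
Qed.
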